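(* Let $p\ge1$, $I\in\mathbb N_{>0}$, $\alpha_i\in(0,1)$ for $i\in[I]$, $g\in\mathbb R^\ell$, and let $\mathcal X\subset\mathbb R^\ell$ be closed and convex. Let $\Xi\subset\mathbb R^d=\mathbb R^{d_1}\times\cdots\times\mathbb R^{d_n}$, let $Q=\sum_{l=1}^M\vartheta_l\delta_{\xi^l}$ be a discrete distribution with atoms $\xi^1,\ldots,\xi^M\in\Xi$ and masses $\vartheta_1,\ldots,\vartheta_M$, and let $\bm\varepsilon=(\varepsilon_1,\ldots,\varepsilon_n)\succeq0$. Let $f_i:\mathcal X\times\Xi\to\mathbb R$, $i\in[I]$, be such that (i) for each $i\in[I]$ and $\xi\in\Xi$ the function $x\mapsto f_i(x,\xi)$ is convex, and (ii) there exists $r\in[0,p)$ such that for each $i\in[I]$ and $x\in\mathcal X$ the function $\xi\mapsto f_i(x,\xi)$ is continuous and belongs to the growth class $\mathcal G_r$. Assume further that $\Xi:=\{\xi\in\mathbb R^d:\ C\xi\preceq h\}$ is compact, where $C\in\mathbb R^{q\times d}$ and $h\in\mathbb R^q$, and that $f_i(x,\xi):=\max_{j\in[m]}\big(\langle x,A_{ji}\xi\rangle+b_{ji}(x)\big)$, where $A_{ji}\in\mathbb R^{\ell\times d}$ and each $b_{ji}:\mathbb R^\ell\to\mathbb R$ is convex. Then the distributionally robust CVaR-constrained problem $$\begin{aligned}\inf_{x\in\mathcal X}\ &\langle g,x\rangle\\ \text{s.t.}\ &\sup_{P\in\mathcal T_p(Q,\bm\varepsilon)}\inf_{\tau\in\mathbb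 R}\mathbb E_P[(f_i(x,\xi)+\tau)_+-\tau\alpha_i]\le0,\quad i\in[I],\end{aligned}$$ is equivalent to the convex optimization problem $$\begin{aligned}\inf_{x\in\mathcal X,\,\tau_i,\,\bm\lambda_i,\,s_{li},\,\eta_{lji}}\ &\langle g,x\rangle\\ \text{s.t.}\ \ &\langle\bm\lambda_i,\bm\varepsilon\rangle+\sum_{l=1}^M\vartheta_l s_{li}\le\tau_i\alpha_i,&& i\in[I],\\ &b_{ji}(x)+\tau_i+\langle A_{ji}^\top x-C^\top\eta_{lji},\xi^l\rangle+\langle\eta_{lji},h\rangle\le s_{li},&& l\in[M],\ j\in[m],\ i\in[I],\\ &\|\mathrm{pr}_k^{\bm d}(A_{ji}^\top x-C^\top\eta_{lji})\|_*\le\lambda_{ik},&& l\in[M],\ j\in[m],\ i\in[I],\ k\in[n],\\ &s_{li}\ge0,\ \eta_{lji}\succeq0,&& l\in[M],\ j\in[m],\ i\in[I],\end{aligned}$$ where $\bm\lambda_i:=(\lambda_{i1},\ldots,\lambda_{in})$ and $\bm d:=(d_1,\ldots,d_n)$.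
   Context: In the second problem the variables are $x\in\mathcal X$, $\tau_i\in\mathbb R$, $\bm\lambda_i\in\mathbb R^n$, $s_{li}\in\mathbb R$, and $\eta_{lji}\in\mathbb R^q$. Notation: $[N]:=\{1,\ldots,N\}$; $x_+:=\max\{x,0\}$; $x\succeq y$ (equivalently $y\preceq x$) means all components of $x-y$ are nonnegative; $d=d_1+\cdots+d_n$; elements of $\mathbb R^d$ are written $\xi=(\xi_1,\ldots,\xi_n)$ with $\xi_k\in\mathbb R^{d_k}$, and $\mathrm{pr}_k^{\bm d}(\xi)=\xi_k$. $\mathbb R^d$ and each $\mathbb R^{d_k}$ carry an (arbitrary) norm denoted $\|\cdot\|$, with dual norm $\|z\|_*:=\sup_{\|\xi\|\le1}\langle z,\xi\rangle$. The class $\mathcal G_r$ consists of the real-valued functions $\phi$ on $\Xi$ such that both $\phi$ and $-\phi$ satisfy a bound of the form $\phi(\xi)\le c(1+\|\zeta-\xi\|^r)$ (resp. $-\phi(\xi)\le c(1+\|\zeta-\xi\|^r)$) for all $\xi\in\Xi$, for some $c>0$ and $\zeta\in\Xi$. With $\mathcal P(\cdot)$ denoting Borel probability measures, the multi-transport hyperrectangle is $$\mathcal T_p(Q,\bm\varepsilon):=\Big\{\mathrm{pr}_{2\#}\pi:\ \pi\in\mathcal P(\Xi\times\Xi),\ \mathrm{pr}_{1\#}\pi=Q,\ \int_{\Xi\times\Xi}\|\zeta_k-\xi_k\|^p\,d\pi(\zeta,\xi)\le\varepsilon_k^p\ \text{for all }k\in[n]\Big\},$$ where $\mathrm{pr}_{1\#}\pi,\mathrm{pr}_{2\#}\pi$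 are the first and second marginals of $\pi$.
   Formalization: The equivalence fails for p > 1 (p=2, Ξ=[-10,10], Q=δ_0, ε=1, α=1/4, X={1}, f=xξ-3), so it is proved for p = 1 only; for every p ≥ 1 the second problem is shown convex and a safe approximation: its feasible x are feasible for the first, and the first infimum is at most the second. *)

(* Defs.v *)
From HB Require Import structures.
From mathcomp Require Import all_boot all_order all_algebra.
From mathcomp Require Import all_classical all_reals all_analysis.

Set Implicit Arguments.
Unset Strict Implicit.
Unset Printing Implicit Defensive.

Import Order.TTheory GRing.Theory Num.Theory.
Import numFieldNormedType.Exports.

Local Open Scope classical_set_scope.
Local Open Scope ring_scope.

(* R^n is ['cV[R]_n].  With block sizes [d : 'I_n -> nat], the product
   R^(d_1) x ... x R^(d_n) is ['cV[R]_(\sum_k d k)] and the k-th projection of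
   [xi] is [submxcol xi k]. *)

Definition dot (R : realType) (n : nat) (u v : 'cV[R]_n) : R :=
  \sum_i u i 0 * v i 0.

(* An arbitrary norm, unrelated to the max norm that MathComp-Analysis puts on
   matrices (only the topology of the latter is used below). *)
Definition is_norm (R : realType) (V : lmodType R) (N : V -> R) : Prop :=
  [/\ forall u v, N (u + v) <= N u + N v,
      forall (a : R) u, N (a *: u) = `|a| * N u
    & forall u, N u = 0 -> u = 0].

Definition dual_norm (R : realType) (n : nat) (N : 'cV[R]_n -> R)
    (z : 'cV[R]_n) : \bar R :=
  ereal_sup [set (dot z xi)%:E | xi in [set xi | N xi <= 1]].

Definition polyhedron (R : realType) (q d : nat)
    (C : 'M[R]_(q, d)) (h : 'cV[R]_q) : set 'cV[R]_d :=
  [set xi | forall a, (C *m xi) a 0 <= h a 0].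

Definition growth_bound (R : realType) (d : nat) (N : 'cV[R]_d -> R)
    (Xi : set 'cV[R]_d) (r : R) (phi : 'cV[R]_d -> R) : Prop :=
  exists c : R, exists zeta : 'cV[R]_d,
    [/\ 0 < c, Xi zeta &
        forall xi, Xi xi -> phi xi <= c * (1 + N (zeta - xi) `^ r)].

Definition growth_class (R : realType) (d : nat) (N : 'cV[R]_d -> R)
    (Xi : set 'cV[R]_d) (r : R) (phi : 'cV[R]_d -> R) : Prop :=
  growth_bound N Xi r phi /\ growth_bound N Xi r (fun xi => - phi xi).

Notation borel T := (g_sigma_algebraType (@open T)).

(* A Borel probability measure on a Borel set [Xi] is represented by a Borel
   probability measure on the ambient space that gives mass 1 to [Xi].
   Marginals are compared on measurable sets only: the values of a measure on
   other sets carry no meaning. *)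
Definition transport_hyperrectangle (R : realType) (n : nat) (d : 'I_n -> nat)
    (Nk : forall k, 'cV[R]_(d k) -> R) (Xi : set 'cV[R]_(\sum_k d k))
    (p : R) (Q : probability (borel 'cV[R]_(\sum_k d k)) R) (eps : 'cV[R]_n) :
    set (probability (borel 'cV[R]_(\sum_k d k)) R) :=
  [set P : probability (borel 'cV[R]_(\sum_k d k)) R | exists pi : probability
       (borel ('cV[R]_(\sum_k d k) * 'cV[R]_(\sum_k d k))%type) R,
     [/\ (pi (Xi `*` Xi) = 1)%E,
         forall B : set (borel 'cV[R]_(\sum_k d k)), measurable B ->
           pi (fst @^-1` B) = Q B,
         forall B : set (borel 'cV[R]_(\sum_k d k)), measurable B ->
           pi (snd @^-1` B) = P B
       & forall k,
           (\int[pi]_(w in Xi `*` Xi)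
              ((Nk k (submxcol w.1 k - submxcol w.2 k)) `^ p)%:E
            <= ((eps k 0) `^ p)%:E)%E]].

Record problem (R : realType) (V : lmodType R) := Problem {
  feasible : set V;
  objective : V -> R }.

Definition optimal_value (R : realType) (V : lmodType R) (P : problem V) :
    \bar R :=
  ereal_inf [set (objective P v)%:E | v in feasible P].

Definition minimizers (R : realType) (V : lmodType R) (P : problem V) : set V :=
  [set v | feasible P v /\
           forall w, feasible P w -> objective P v <= objective P w].

Definition convex_problem (R : realType) (V : lmodType R) (P : problem V) :
    Prop :=
  convex_set (feasible P) /\ convex_function (feasible P) (objective P).

Definition equivalent_via (R : realType) (U V : lmodType R) (pr : V -> U)
    (P1 : problem U) (P2 : problem V) : Prop :=
  [/\ feasible P1 = pr @` feasible P2,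
      forall v, feasible P2 v -> objective P1 (pr v) = objective P2 v,
      optimal_value P1 = optimal_value P2
    & minimizers P1 = pr @` minimizers P2].

(* [P2] is a safe approximation of [P1].  The reformulated problem below does
   not depend on the transport exponent p: it is exact for p = 1, and only a
   safe approximation for p > 1.  Exactness fails for instance for p = 2,
   Xi = [-10, 10], Q = \d_0, eps = 1, alpha = 1/4, X = {1},
   f(x, xi) = x xi - 3: then E[(f + 2)_+] <= E[xi^2 / 4] <= 2 alpha, so that
   x = 1 is feasible for the robust problem, whereas the reformulated problem
   is infeasible. *)
Definition conservative_via (R : realType) (U V : lmodType R) (pr : V -> U)
    (P1 : problem U) (P2 : problem V) : Prop :=
  [/\ pr @` feasible P2 `<=` feasible P1,
      forall v, feasible P2 v -> objective P1 (pr v) = objective P2 v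
    & (optimal_value P1 <= optimal_value P2)%E].

Definition cvar_integral (R : realType) (d : nat) (Xi : set 'cV[R]_d)
    (P : probability (borel 'cV[R]_d) R) (phi : 'cV[R]_d -> R) (alpha : R) :
    \bar R :=
  ereal_inf [set (\int[P]_(xi in Xi)
                    (Num.max (phi xi + tau) 0 - tau * alpha)%:E)%E
            | tau in [set: R]].

Definition dro_problem (R : realType) (ell NI n : nat) (d : 'I_n -> nat)
    (g : 'cV[R]_ell) (X : set 'cV[R]_ell) (Xi : set 'cV[R]_(\sum_k d k))
    (T : set (probability (borel 'cV[R]_(\sum_k d k)) R))
    (alpha : 'I_NI -> R) (f : 'I_NI -> 'cV[R]_ell -> 'cV[R]_(\sum_k d k) -> R) :
    problem 'cV[R]_ell :=
  Problem
    [set x | X x /\ forall i,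
       (ereal_sup [set cvar_integral Xi P (f i x) (alpha i) | P in T] <= 0)%E]
    (dot g).

(* The variables (x, tau, lambda, s, eta). *)
Definition reform_vars (R : realType) (ell NI n M m q : nat) : lmodType R :=
  ('cV[R]_ell * ('I_NI -> R^o) * ('I_NI -> 'cV[R]_n)
   * ('I_M -> 'I_NI -> R^o) * ('I_M -> 'I_m -> 'I_NI -> 'cV[R]_q))%type.

Definition var_x (R : realType) (ell NI n M m q : nat)
    (v : reform_vars R ell NI n M m q) : 'cV[R]_ell := v.1.1.1.1.

Definition reform_feasible (R : realType) (ell NI n M m q : nat)
    (d : 'I_n -> nat) (Nk : forall k, 'cV[R]_(d k) -> R)
    (X : set 'cV[R]_ell) (C : 'M[R]_(q, \sum_k d k)) (h : 'cV[R]_q)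
    (theta : 'I_M -> R) (atom : 'I_M -> 'cV[R]_(\sum_k d k)) (eps : 'cV[R]_n)
    (alpha : 'I_NI -> R) (A : 'I_m -> 'I_NI -> 'M[R]_(ell, \sum_k d k))
    (b : 'I_m -> 'I_NI -> 'cV[R]_ell -> R) :
    set (reform_vars R ell NI n M m q) :=
  [set v | let: (x, tau, lambda, s, eta) := v in
    [/\ X x,
        forall i,
          dot (lambda i) eps + \sum_l theta l * s l i <= tau i * alpha i,
        forall l j i,
          b j i x + tau i + dot ((A j i)^T *m x - C^T *m eta l j i) (atom l)
            + dot (eta l j i) h <= s l i,
        forall l j i k,
          (dual_norm (Nk k) (submxcol ((A j i)^T *m x - C^T *m eta l j i) k)
           <= (lambda i k 0)%:E)%E
      & forall l j i, 0 <= s l i /\ forall a, 0 <= eta l j i a 0]].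

Definition reform_problem (R : realType) (ell NI n M m q : nat)
    (d : 'I_n -> nat) (Nk : forall k, 'cV[R]_(d k) -> R)
    (g : 'cV[R]_ell) (X : set 'cV[R]_ell)
    (C : 'M[R]_(q, \sum_k d k)) (h : 'cV[R]_q)
    (theta : 'I_M -> R) (atom : 'I_M -> 'cV[R]_(\sum_k d k)) (eps : 'cV[R]_n)
    (alpha : 'I_NI -> R) (A : 'I_m -> 'I_NI -> 'M[R]_(ell, \sum_k d k))
    (b : 'I_m -> 'I_NI -> 'cV[R]_ell -> R) :
    problem (reform_vars R ell NI n M m q) :=
  Problem (reform_feasible Nk X C h theta atom eps alpha A b)
          (fun v => dot g (var_x v)).

(* Main.v *)
Require Import Defs.
From HB Require Import structures.
From mathcomp Require Import all_boot all_order all_algebra.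
From mathcomp Require Import all_classical all_reals all_analysis.
From mathcomp Require Import measurable_realfun ring lra.
Import Order.TTheory GRing.Theory Num.Theory.
Import numFieldNormedType.Exports.
Local Open Scope classical_set_scope.
Local Open Scope ring_scope.

Set Implicit Arguments.
Unset Strict Implicit.
Unset Printing Implicit Defensive.

(* For fixed x the constraints decouple over i.  Weak duality gives the safe
   approximation: along a transport plan started at an atom, a feasible
   (tau, lambda, s, eta) bounds (f + tau)_+ by s_l + sum_k lambda_k |zeta_k - xi_k|,
   and Jensen's inequality bounds the mean displacements by eps.

   For p = 1 the converse is linear duality with infinitely many constraints: the
   dual norm constraints are the inequalities <z_k, u> <= lambda_k |u| for all u.
   Such inequalities form a cone of implied constraints, and a point satisfying all
   of them is found one coordinate at a time, as in Fourier-Motzkin elimination: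
   finitely many constraints involve the unbounded unknowns, and for the remaining
   ones, which are bounded from both sides by implied constraints, the supremum of
   the lower bounds is an admissible value.  The blocks with eps_k = 0 impose no
   dual norm constraint, because lambda_k costs nothing there.  If the cone contains
   an absurd inequality 0 <= c < 0, its multipliers (mu, y) are the masses and the
   scaled displacements of a transport plan with finite support that violates the
   robust constraint uniformly in tau; hence no exchange of sup and inf is needed. *)

(** * Linear inequalities *)

(** The pair [(a, c)] stands for [a . w <= c]. Coefficients are finite functions, so that equality
    is decidable and constraints can be collected in lists with a membership test. *)
Definition constr (R : realType) (J : finType) : Type := ({ffun J -> R} * R)%type.

Section LinearInequalities.
Variables (R : realType) (J : finType).
Implicit Types (p q : constr R J) (w : J -> R) (S K : set (constr R J)) (j : J).

Definition pairing (a w : J -> R) : R := \sum_j a j * w j.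

Definition satisfies w p : Prop := pairing p.1 w <= p.2.

Definition comb (s t : R) p q : constr R J :=
  ([ffun j => s * p.1 j + t * q.1 j], s * p.2 + t * q.2).

Definition is_cone K : Prop :=
  forall s t p q, 0 <= s -> 0 <= t -> K p -> K q -> K (comb s t p q).

Definition upd w j (t : R) : J -> R := fun k => if k == j then t else w k.

Lemma pairing_upd a w j t : pairing a (upd w j t) = pairing a w + a j * (t - w j).
Proof.
rewrite /pairing (bigD1 j)//= [in RHS](bigD1 j)//= /upd eqxx.
rewrite (eq_bigr (fun k => a k * w k)) => [|k /negPf->//].
ring.
Qed.

Lemma pairing_comb s t p q w :
  pairing (comb s t p q).1 w = s * pairing p.1 w + t * pairing q.1 w.
Proof.
rewrite /pairing !mulr_sumr -big_split/=; apply: eq_bigr => j _.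
by rewrite ffunE; ring.
Qed.

Lemma pairing0 a w : (forall j, w j = 0) -> pairing a w = 0.
Proof. by move=> w0; rewrite /pairing big1// => j _; rewrite w0 mulr0. Qed.

(** The supremum of [A] serves; any element of [B] shows that [A] is bounded above. *)
Lemma between_set (A B : set R) : A !=set0 -> B !=set0 ->
  (forall x y, A x -> B y -> x <= y) ->
  exists t, (forall x, A x -> x <= t) /\ (forall y, B y -> t <= y).
Proof.
move=> A0 [b Bb] AB; exists (sup A); split => [x Ax|y By].
  by apply: ub_le_sup => //; exists b => z Az; exact: AB.
by apply: ge_sup => // x Ax; exact: AB.
Qed.

Lemma has_ub_seq (s : seq R) : exists t, forall x, x \in s -> x <= t.
Proof.
elim: s => [|a s [t st]]; first by exists 0.
exists (Num.max a t) => x; rewrite inE => /predU1P[->|/st xt].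
  by rewrite le_max lexx.
by rewrite le_max xt orbT.
Qed.

Lemma between_seq (A B : seq R) :
  (forall x y, x \in A -> y \in B -> x <= y) ->
  exists t, (forall x, x \in A -> x <= t) /\ (forall y, y \in B -> t <= y).
Proof.
move=> AB.
have [t1 ht1] := has_ub_seq A; have [t2 ht2] := has_ub_seq [seq - x | x <- B].
have {}ht2 y : y \in B -> - t2 <= y.
  by move=> yB; rewrite lerNl ht2// map_f.
(* Each list is padded with one value compatible with all the inequalities, built from an upper
   bound of [A] and a lower bound of [B], so that empty lists need no separate treatment. *)
have [t [ht hAt]] : exists t, (forall x, [set` A] x \/ x = Num.min t1 (- t2) -> x <= t)
    /\ (forall y, [set` B] y \/ y = Num.max t1 (- t2) -> t <= y).
  apply: (@between_set [set x | [set` A] x \/ x = Num.min t1 (- t2)]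
    [set y | [set` B] y \/ y = Num.max t1 (- t2)]).
  - by exists (Num.min t1 (- t2)); right.
  - by exists (Num.max t1 (- t2)); right.
  - move=> x y [xA|->] [yB|->].
    + exact: AB.
    + by rewrite le_max ht1.
    + by rewrite ge_min ht2// orbT.
    + by rewrite ge_min le_max lexx.
by exists t; split => z zX; [apply: ht; left|apply: hAt; left].
Qed.

(* The value of the [j]-th variable at which [p] becomes tight, the other
   variables being those of [w]. *)
Definition tight w j p : R := w j + (p.2 - pairing p.1 w) / p.1 j.

Lemma satisfies_upd_gt0 w j t p : 0 < p.1 j ->
  satisfies (upd w j t) p <-> t <= tight w j p.
Proof.
move=> pj; rewrite /satisfies pairing_upd /tight -lerBlDl ler_pdivlMr// mulrC.
by rewrite lerBrDl.
Qed.

Lemma satisfies_upd_lt0 w j t p : p.1 j < 0 ->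
  satisfies (upd w j t) p <-> tight w j p <= t.
Proof.
move=> pj; rewrite /satisfies pairing_upd -lerBrDl [p.1 j * _]mulrC.
by rewrite -ler_ndivrMr// lerBrDl.
Qed.

(** The weights [q.1 j] and [- p.1 j] are positive and cancel the variable [j]. Divided by their
    product, the combined inequality compares the lower bound given by [p] with the upper bound
    given by [q]. *)
Lemma tight_le w j p q : p.1 j < 0 -> 0 < q.1 j ->
  satisfies w (comb (q.1 j) (- p.1 j) p q) -> tight w j p <= tight w j q.
Proof.
move=> pj qj; rewrite /satisfies pairing_comb /= => h.
rewrite lerD2l ler_pdivlMr//; rewrite mulrAC ler_ndivrMr//.
by lra.
Qed.

Lemma comb_cancel j p q : (comb (q.1 j) (- p.1 j) p q).1 j = 0.
Proof. by rewrite ffunE; ring. Qed.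

Lemma satisfies_upd_eq0 w j t p : p.1 j = 0 ->
  satisfies (upd w j t) p <-> satisfies w p.
Proof. by move=> pj; rewrite /satisfies pairing_upd pj mul0r addr0. Qed.

Definition vanishes (js : seq J) p : Prop := forall j, j \in js -> p.1 j = 0.

Lemma vanishes_cone js : is_cone (vanishes js).
Proof. by move=> s t p q _ _ hp hq j jjs; rewrite ffunE hp// hq// !mulr0 addr0. Qed.

Lemma is_coneI K1 K2 : is_cone K1 -> is_cone K2 -> is_cone (K1 `&` K2).
Proof.
by move=> h1 h2 s t p q s0 t0 [? ?] [? ?]; split; [exact: h1|exact: h2].
Qed.

(** Constraints free of [j] are kept, and each lower bound is combined with each upper bound so that
    [j] cancels. The first clause ranges over all cones [K], because it is used both for implied
    constraints and for constraints in which a variable vanishes. *)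
Lemma fourier_motzkin_step (F : seq (constr R J)) j :
  exists F' : seq (constr R J),
  [/\ forall K, is_cone K -> (forall p, p \in F -> K p) ->
        forall p, p \in F' -> K p,
      forall p, p \in F' -> p.1 j = 0
    & forall w, (forall p, p \in F' -> satisfies w p) ->
        exists t, forall p, p \in F -> satisfies (upd w j t) p].
Proof.
pose P := [seq p : constr R J <- F | 0 < p.1 j].
pose M := [seq p : constr R J <- F | p.1 j < 0].
pose Z := [seq p : constr R J <- F | p.1 j == 0].
pose C := [seq comb (q.1 j) (- p.1 j) p q | p <- M, q <- P].
exists (Z ++ C); split.
- move=> K coneK FK p; rewrite mem_cat mem_filter => /orP[/andP[_ /FK//]|].
  move=> /allpairsP[[a b] [/= aM bP ->]].
  move: aM bP; rewrite !mem_filter => /andP[aj aF] /andP[bj bF].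
  by apply: coneK; [exact: ltW|rewrite oppr_ge0 ltW|exact: FK|exact: FK].
- move=> p; rewrite mem_cat mem_filter => /orP[/andP[/eqP//]|].
  by move=> /allpairsP[[a b] [_ _ ->]]; exact: comb_cancel.
- move=> w hw.
  have [|t [tM tP]] :=
      @between_seq [seq tight w j p | p <- M] [seq tight w j p | p <- P].
    move=> _ _ /mapP[p pM ->] /mapP[q qP ->].
    have := pM; have := qP; rewrite !mem_filter => /andP[qj _] /andP[pj _].
    apply: tight_le => //; apply: hw.
    by rewrite mem_cat; apply/orP; right; apply/allpairsP; exists (p, q).
  exists t => p pF; have [pj|pj|pj] := ltrgtP (p.1 j) 0.
  + by apply/satisfies_upd_lt0 => //; rewrite tM// map_f// mem_filter pj.
  + by apply/satisfies_upd_gt0 => //; rewrite tP// map_f// mem_filter pj.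
  + apply/satisfies_upd_eq0 => //; apply: hw.
    by rewrite mem_cat mem_filter pj eqxx pF.
Qed.

Lemma fourier_motzkin (js : seq J) (F : seq (constr R J)) :
  exists F' : seq (constr R J),
  [/\ forall K, is_cone K -> (forall p, p \in F -> K p) ->
        forall p, p \in F' -> K p,
      forall p, p \in F' -> vanishes js p
    & forall w, (forall p, p \in F' -> satisfies w p) ->
        exists w', (forall j, j \notin js -> w' j = w j) /\
          forall p, p \in F -> satisfies w' p].
Proof.
elim: js F => [|j js IH] F; first by exists F; split => // w hw; exists w.
have [F1 [F1K F1j F1w]] := fourier_motzkin_step F j.
have [F2 [F2K F2j F2w]] := IH F1.
exists F2; split.
- by move=> K coneK FK; apply: F2K => //; exact: F1K.
- move=> p pF2 k; rewrite inE => /predU1P[->|]; last exact: F2j.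
  (* Later eliminations do not bring [j] back: the constraints vanishing at [j] form a cone. *)
  suff : vanishes [:: j] p by apply; rewrite inE.
  apply: (F2K (vanishes [:: j])) => //; first exact: vanishes_cone.
  by move=> q qF1 i; rewrite inE => /eqP ->; exact: F1j.
- move=> w /F2w[w' [w'w /F1w[t ht]]]; exists (upd w' j t); split => // k.
  by rewrite inE negb_or => /andP[kj kjs]; rewrite /upd (negPf kj) w'w.
Qed.

(** With infinitely many constraints the new value is a supremum of lower bounds. Coefficients of
    both signs must occur in [K] for the sets of lower and upper bounds to be nonempty. *)
Lemma cone_extension_step K j w : is_cone K ->
  (exists p, K p /\ 0 < p.1 j) -> (exists p, K p /\ p.1 j < 0) ->
  (forall p, K p -> p.1 j = 0 -> satisfies w p) ->
  exists t, forall p, K p -> satisfies (upd w j t) p.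
Proof.
move=> coneK [p0 [Kp0 p0j]] [q0 [Kq0 q0j]] hw.
have [|||t [tM tP]] := @between_set
    [set tight w j p | p in [set p | K p /\ p.1 j < 0]]
    [set tight w j p | p in [set p | K p /\ 0 < p.1 j]].
- by exists (tight w j q0), q0.
- by exists (tight w j p0), p0.
- move=> _ _ [p [Kp pj] <-] [q [Kq qj] <-].
  apply: tight_le => //; apply: hw; last exact: comb_cancel.
  by apply: coneK => //; rewrite ?oppr_ge0 ltW.
exists t => p Kp; have [pj|pj|pj] := ltrgtP (p.1 j) 0.
- by apply/satisfies_upd_lt0 => //; apply: tM; exists p.
- by apply/satisfies_upd_gt0 => //; apply: tP; exists p.
- by apply/satisfies_upd_eq0 => //; exact: hw.
Qed.

Definition signed_unit (b : bool) j : {ffun J -> R} :=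
  [ffun k => (-1) ^+ b * (k == j)%:R].

(** The value of the first variable is chosen against the constraints of [K] that vanish on the
    remaining ones, which again form a cone; induction then sets the remaining variables. *)
Lemma cone_extension K (js : seq J) w : is_cone K ->
  (forall j b, j \in js -> exists c, K (signed_unit b j, c)) ->
  (forall p, K p -> vanishes js p -> satisfies w p) ->
  exists w', (forall j, j \notin js -> w' j = w j) /\
    forall p, K p -> satisfies w' p.
Proof.
move=> coneK; elim: js w => [|j js IH] w bnd hw.
  by exists w; split => // p Kp; exact: hw.
have {}IH w' := IH w' (fun k b kjs => bnd k b (mem_behead (s := j :: js) kjs)).
have [jjs|jjs] := boolP (j \in js).
  have [|w' [w'w hw']] := IH w.
    move=> p Kp pjs; apply: hw => // k; rewrite inE => /predU1P[->|]; exact: pjs.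
  by exists w'; split => // k; rewrite inE negb_or => /andP[_ /w'w].
have unit_js b c : vanishes js (signed_unit b j, c).
  move=> k kjs /=; rewrite ffunE (_ : (k == j) = false) ?mulr0//.
  by apply/negbTE; apply: contraNneq jjs => <-.
have [||||t ht] := @cone_extension_step (K `&` vanishes js) j w.
- by apply: is_coneI => //; exact: vanishes_cone.
- have [|c Kc] := bnd j false; first exact: mem_head.
  by exists (signed_unit false j, c); rewrite /= ffunE eqxx mulr1 expr0.
- have [|c Kc] := bnd j true; first exact: mem_head.
  by exists (signed_unit true j, c); rewrite /= ffunE eqxx mulr1 expr1 ltrN10.
- move=> p [Kp pjs] pj; apply: hw => // k.
  by rewrite inE => /predU1P[->//|]; exact: pjs.
have [|w' [w'w hw']] := IH (upd w j t); first by move=> p Kp pjs; exact: ht.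
exists w'; split => // k; rewrite inE negb_or => /andP[kj kjs].
by rewrite w'w// /upd (negPf kj).
Qed.

(* Only the finite part [F] may involve unbounded variables, since with infinitely
   many one-sided constraints on a variable the cone [K] need not be closed. *)
Lemma semi_infinite_farkas K (F : seq (constr R J)) (js : seq J) :
  is_cone K -> (forall p, p \in F -> K p) ->
  (forall j b, j \in js -> exists c, K (signed_unit b j, c)) ->
  (forall p, K p -> p.1 = [ffun=> 0] -> 0 <= p.2) ->
  exists w, (forall p, p \in F -> satisfies w p) /\
    forall p, K p -> (forall j, j \notin js -> p.1 j = 0) -> satisfies w p.
Proof.
move=> coneK FK bnd K0.
(* The variables in [js1] may be unbounded. They are eliminated from [F], the bounded ones are then
   determined against the part of [K] free of [js1], and back substitution recovers the values on
   [js1]. *)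
pose js1 := [seq j <- enum J | j \notin js].
have mem_js1 j : (j \in js1) = (j \notin js) by rewrite mem_filter mem_enum andbT.
pose K1 := K `&` vanishes js1.
have coneK1 : is_cone K1 by apply: is_coneI => //; exact: vanishes_cone.
have [F' [F'K F'js1 F'w]] := fourier_motzkin js1 F.
have [||w [_ hw]] := @cone_extension K1 js (fun=> 0) coneK1.
- move=> j b jjs; have [c Kc] := bnd _ b jjs; exists c; split => // k.
  rewrite mem_js1 => kjs; rewrite /= ffunE (_ : (k == j) = false) ?mulr0//.
  by apply/negbTE; apply: contraNneq kjs => ->.
- move=> p [Kp pjs1] pjs; rewrite /satisfies pairing0//; apply: K0 => //.
  apply/ffunP => j; rewrite ffunE.
  by have [/pjs//|jjs] := boolP (j \in js); rewrite pjs1// mem_js1.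
have [p pF'|w' [w'w hw']] := F'w w.
  by apply: hw; split; [exact: (F'K K)|exact: F'js1].
exists w'; split => // p Kp pjs.
have := hw p; rewrite /satisfies.
rewrite (_ : pairing _ w' = pairing p.1 w).
  by apply; split => // j; rewrite mem_js1; exact: pjs.
apply: eq_bigr => j _; have [jjs|jjs] := boolP (j \in js).
  by rewrite w'w// mem_js1 negbK.
by rewrite pjs// !mul0r.
Qed.

End LinearInequalities.

(** * Vectors, blocks and norms *)

Section Dot.
Variables (R : realType).

Lemma dotC n (u v : 'cV[R]_n) : dot u v = dot v u.
Proof. by apply: eq_bigr => i _; rewrite mulrC. Qed.

Lemma dotDl n (u v w : 'cV[R]_n) : dot (u + v) w = dot u w + dot v w.
Proof. by rewrite /dot -big_split; apply: eq_bigr => i _; rewrite mxE mulrDl. Qed.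

Lemma dotZl n (a : R) (u v : 'cV[R]_n) : dot (a *: u) v = a * dot u v.
Proof. by rewrite /dot mulr_sumr; apply: eq_bigr => i _; rewrite mxE mulrA. Qed.

Lemma dotDr n (u v w : 'cV[R]_n) : dot u (v + w) = dot u v + dot u w.
Proof. by rewrite dotC dotDl !(dotC u). Qed.

Lemma dotZr n (a : R) (u v : 'cV[R]_n) : dot u (a *: v) = a * dot u v.
Proof. by rewrite dotC dotZl dotC. Qed.

Lemma dotNl n (u v : 'cV[R]_n) : dot (- u) v = - dot u v.
Proof. by rewrite -scaleN1r dotZl mulN1r. Qed.

Lemma dotNr n (u v : 'cV[R]_n) : dot u (- v) = - dot u v.
Proof. by rewrite dotC dotNl dotC. Qed.

Lemma dotBl n (u v w : 'cV[R]_n) : dot (u - v) w = dot u w - dot v w.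
Proof. by rewrite dotDl dotNl. Qed.

Lemma dotBr n (u v w : 'cV[R]_n) : dot u (v - w) = dot u v - dot u w.
Proof. by rewrite dotDr dotNr. Qed.

Lemma dot0l n (u : 'cV[R]_n) : dot 0 u = 0.
Proof. by rewrite /dot big1// => i _; rewrite mxE mul0r. Qed.

Lemma dot0r n (u : 'cV[R]_n) : dot u 0 = 0.
Proof. by rewrite dotC dot0l. Qed.

Lemma dot_delta n (u : 'cV[R]_n) i : dot u (delta_mx i 0) = u i 0.
Proof.
rewrite /dot (bigD1 i)//= mxE !eqxx mulr1 big1 ?addr0// => k /negPf ki.
by rewrite mxE ki mulr0.
Qed.

Lemma dot_tr n m (B : 'M[R]_(n, m)) u v : dot (B^T *m u) v = dot u (B *m v).
Proof.
rewrite /dot; under eq_bigr do rewrite mxE mulr_suml.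
rewrite exchange_big; apply: eq_bigr => i _; rewrite mxE mulr_sumr.
by apply: eq_bigr => j _; rewrite mxE; ring.
Qed.

Lemma ler_dotr n (u v w : 'cV[R]_n) :
  (forall a, 0 <= u a 0) -> (forall a, v a 0 <= w a 0) -> dot u v <= dot u w.
Proof. by move=> u0 vw; apply: ler_sum => i _; apply: ler_wpM2l. Qed.

End Dot.

Section Blocks.
Variables (R : realType) (n : nat) (d : 'I_n -> nat).
Implicit Types u v : 'cV[R]_(\sum_k d k).

Lemma dot_blocks u v : dot u v = \sum_k dot (submxcol u k) (submxcol v k).
Proof.
rewrite /dot (reindex tagnat.rank)/=; last exact/onW_bij/tagnat.rank_bij.
rewrite [RHS](sig_big_dep _ (fun _ => xpredT)
  (fun k j => submxcol u k j 0 * submxcol v k j 0))/=.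
by apply: eq_bigr => -[k j] _; rewrite !mxE.
Qed.

Lemma submxcolZ (a : R) u k : submxcol (a *: u) k = a *: submxcol u k.
Proof. by apply/matrixP => i j; rewrite !mxE. Qed.

Definition block_embed k (e : 'cV[R]_(d k)) : 'cV[R]_(\sum_k d k) :=
  \mxcol_k' dfwith (fun k' => 0 : 'cV[R]_(d k')) k e k'.

Lemma block_embedE k (e : 'cV[R]_(d k)) : submxcol (block_embed e) k = e.
Proof. by rewrite mxcolK dfwithin. Qed.

Lemma block_embed_neq k k' (e : 'cV[R]_(d k)) :
  k != k' -> submxcol (block_embed e) k' = 0.
Proof. by move=> kk'; rewrite mxcolK dfwithout. Qed.

Lemma dot_block_embed k (e : 'cV[R]_(d k)) v :
  dot v (block_embed e) = dot (submxcol v k) e.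
Proof.
rewrite dot_blocks (bigD1 k)//= block_embedE big1 ?addr0// => k' kk'.
by rewrite block_embed_neq ?dot0r// eq_sym.
Qed.

End Blocks.

Section Norms.
Variables (R : realType) (V : lmodType R) (N : V -> R).
Hypothesis hN : is_norm N.

Lemma norm_tri u v : N (u + v) <= N u + N v.
Proof. by case: hN. Qed.

Lemma norm_scale a u : N (a *: u) = `|a| * N u.
Proof. by case: hN. Qed.

Lemma norm_eq0 u : N u = 0 -> u = 0.
Proof. by case: hN => _ _; apply. Qed.

Lemma norm_zero : N 0 = 0.
Proof. by rewrite -(scale0r 0) norm_scale normr0 mul0r. Qed.

Lemma norm_opp u : N (- u) = N u.
Proof. by rewrite -scaleN1r norm_scale normrN normr1 mul1r. Qed.

Lemma norm_nneg u : 0 <= N u.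
Proof.
have := norm_tri u (- u); rewrite subrr norm_zero norm_opp; lra.
Qed.

Lemma norm_comb s t u v : 0 <= s -> 0 <= t ->
  N (s *: u + t *: v) <= s * N u + t * N v.
Proof.
by move=> s0 t0; rewrite (le_trans (norm_tri _ _))// !norm_scale !ger0_norm//.
Qed.

End Norms.

Lemma sum_lin (R : realType) (I : finType) (s t : R) (f g : I -> R) :
  \sum_i (s * f i + t * g i) = s * (\sum_i f i) + t * (\sum_i g i).
Proof. by rewrite big_split/= !mulr_sumr. Qed.

Lemma sum2_lin (R : realType) (I J : finType) (s t : R) (f g : I -> J -> R) :
  \sum_i \sum_j (s * f i j + t * g i j) =
  s * (\sum_i \sum_j f i j) + t * (\sum_i \sum_j g i j).
Proof. by under eq_bigr do rewrite sum_lin; exact: sum_lin. Qed.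

(** * Equivalence of norms, dual norms and rays in compact sets *)

Section NormTopology.
Variable R : realType.

Lemma ler_coord_norm n m (u : 'M[R]_(n, m)) i j : `|u i j| <= `|u|.
Proof. by rewrite [leRHS]mx_normrE; exact: (le_bigmax _ _ (i, j)). Qed.

(** Expansion in the canonical basis; the constant is the sum of the norms of the basis matrices. *)
Lemma norm_le_mx_norm n m (N : 'M[R]_(n, m) -> R) : is_norm N ->
  exists K, 0 <= K /\ forall u, N u <= K * `|u|.
Proof.
move=> hN; exists (\sum_i \sum_j N (delta_mx i j)).
have N_sum (I : finType) (F : I -> 'M[R]_(n, m)) : N (\sum_i F i) <= \sum_i N (F i).
  apply: (big_ind2 (fun u x => N u <= x)) => [|u x v y ux vy|//].
    by rewrite norm_zero.
  by rewrite (le_trans (norm_tri hN _ _))// lerD.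
split=> [|u].
  by apply: sumr_ge0 => i _; apply: sumr_ge0 => j _; exact: norm_nneg.
rewrite [in leLHS](matrix_sum_delta u) (le_trans (N_sum _ _))// mulr_suml.
apply: ler_sum => i _; rewrite (le_trans (N_sum _ _))// mulr_suml.
apply: ler_sum => j _; rewrite (norm_scale hN) mulrC ler_wpM2l ?norm_nneg//.
exact: ler_coord_norm.
Qed.

Lemma is_norm_continuous n m (N : 'M[R]_(n, m) -> R) : is_norm N -> continuous N.
Proof.
move=> hN x; have [K [K0 hK]] := norm_le_mx_norm hN.
move=> A /nbhs_ballP[e /= e0 eA]; apply/nbhs_ballP; exists (e / (K + 1)) => /=.
  by rewrite divr_gt0// ltr_wpDl.
move=> y; rewrite -ball_normE /ball_/= => xy; apply: eA.
rewrite -ball_normE /ball_/=.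
have : N (x - y) < e.
  rewrite (le_lt_trans (hK _))//; move: xy; rewrite ltr_pdivlMr ?ltr_wpDl//.
  by apply: le_lt_trans; rewrite mulrC ler_wpM2l// lerDl.
have h1 := norm_tri hN (x - y) y; have h2 := norm_tri hN (y - x) x.
rewrite !subrK in h1 h2; rewrite -(norm_opp hN (y - x)) opprB in h2.
by rewrite ltr_norml => h3; apply/andP; split; lra.
Qed.

(** On the unit sphere of the max norm, which is compact, [N] attains a positive minimum; its
    inverse is the constant. *)
Lemma mx_norm_le_norm_rV n (N : 'rV[R]_n -> R) : is_norm N ->
  exists c, 0 <= c /\ forall u, `|u| <= c * N u.
Proof.
move=> hN; pose S := [set u : 'rV[R]_n | `|u| = 1].
(* An empty sphere means that 0 is the only vector, since any other could be normalised. *)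
have [[u0 Su0]|S0] := pselect (S !=set0); last first.
  exists 0; split=> // u; rewrite mul0r normr_le0; apply/negPn/negP => u0.
  apply: S0; exists (`|u|^-1 *: u); rewrite /S/= normrZ normfV normr_id.
  by rewrite mulVf// normr_eq0.
have [|||c] := @compact_EVT_min _ R N S.
- by exists u0.
- apply: bounded_closed_compact.
    by exists 1; split=> // x x1 u; rewrite /S/= => ->; exact: ltW.
  apply: (@preimage_closed _ _ (fun u : 'rV[R]_n => `|u|) [set 1]).
    by move=> u _; exact: norm_continuous.
  exact: closed_eq.
- by apply: continuous_subspaceT => u; exact: is_norm_continuous.
rewrite inE => Sc cmin.
have Nc0 : 0 < N c.
  rewrite lt_def norm_nneg// andbT; apply/eqP => /(norm_eq0 hN) c0.
  by move: Sc; rewrite /S/= c0 normr0 => /esym/eqP; rewrite oner_eq0.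
exists (N c)^-1; split=> [|u]; first by rewrite invr_ge0 ltW.
have [->|u0'] := eqVneq u 0; first by rewrite normr0 norm_zero// mulr0.
rewrite mulrC ler_pdivlMr// -ler_pdivlMl ?normr_gt0//.
have := cmin (`|u|^-1 *: u); rewrite (norm_scale hN) normfV normr_id; apply.
by rewrite inE /S/= normrZ normfV normr_id mulVf// normr_eq0.
Qed.

Lemma norm_trmx n m (u : 'M[R]_(n, m)) : `|u^T| = `|u|.
Proof.
have le_tr k l (v : 'M[R]_(k, l)) : `|v^T| <= `|v|.
  rewrite [leLHS]mx_normrE; apply: bigmax_le => // -[i j] _ /=.
  by rewrite mxE ler_coord_norm.
by apply/eqP; rewrite eq_le le_tr -{1}(trmxK u) le_tr.
Qed.

Lemma mx_norm_le_norm n (N : 'cV[R]_n -> R) : is_norm N ->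
  exists c, 0 <= c /\ forall u, `|u| <= c * N u.
Proof.
move=> hN; have [|c [c0 hc]] := @mx_norm_le_norm_rV n (fun v => N v^T).
  split=> [u v|x u|u Nu]; first by rewrite linearD norm_tri.
    by rewrite linearZ norm_scale.
  by rewrite -(trmxK u) (norm_eq0 hN Nu) trmx0.
by exists c; split=> // u; rewrite -norm_trmx (le_trans (hc _))// trmxK.
Qed.

(** The unit ball of [N] is bounded in the max norm. Finiteness supplies a value of [lambda] in the
    blocks of zero radius. *)
Lemma dual_norm_fin n (N : 'cV[R]_n -> R) (z : 'cV[R]_n) : is_norm N ->
  exists c, (dual_norm N z <= c%:E)%E.
Proof.
move=> hN; have [c [c0 hc]] := mx_norm_le_norm hN.
exists (\sum_i `|z i 0| * c); apply: ge_ereal_sup => _ [u /= Nu1 <-].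
rewrite lee_fin; apply: ler_sum => i _; rewrite (le_trans (ler_norm _))// normrM.
rewrite ler_wpM2l// (le_trans (ler_coord_norm _ _ _))// (le_trans (hc _))//.
by rewrite ler_piMr.
Qed.

(** The Hölder inequality for a norm and its dual, by homogeneity; [u = 0] gives the sign of
    [lambda]. *)
Lemma dual_norm_ge n (N : 'cV[R]_n -> R) (z : 'cV[R]_n) lambda : is_norm N ->
  (dual_norm N z <= lambda%:E)%E ->
  0 <= lambda /\ forall u, dot z u <= lambda * N u.
Proof.
move=> hN hz.
have dual u : N u <= 1 -> dot z u <= lambda.
  move=> Nu; rewrite -lee_fin (le_trans _ hz)//.
  by apply: ereal_sup_ubound; exists u.
split; first by have := dual 0; rewrite norm_zero// dot0r; apply.
move=> u; have [->|u0] := eqVneq u 0; first by rewrite dot0r norm_zero// mulr0.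
have Nu0 : 0 < N u.
  by rewrite lt_def norm_nneg// andbT; apply: contraNneq u0 => /(norm_eq0 hN)->.
rewrite -ler_pdivrMr// mulrC -dotZr dual// (norm_scale hN).
by rewrite gtr0_norm ?invr_gt0// mulVf// gt_eqF.
Qed.

(** A bounded set contains no half-line. For the compact polyhedron this rules out a nonzero
    displacement that carries no mass. *)
Lemma compact_ray n m (A : set 'M[R]_(n, m)) x y : compact A ->
  (forall t, 0 <= t -> A (x + t *: y)) -> y = 0.
Proof.
move=> /compact_bounded[B [_ hB]] ray.
have bnd t : 0 <= t -> t * `|y| <= 2 * (B + 1).
  move=> t0; have hA u : A u -> `|u| <= B + 1 by apply: hB; rewrite ltrDl.
  have h1 := hA _ (ray t t0); have h2 := hA _ (ray 0 (lexx _)).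
  rewrite scale0r addr0 in h2; have h3 := ler_normB (x + t *: y) x.
  rewrite addrAC subrr add0r normrZ (ger0_norm t0) in h3.
  by rewrite (le_trans h3)// mulr2n mulrDl mul1r lerD.
apply/eqP; rewrite -normr_le0 leNgt; apply/negP => y0.
have B0 : 0 <= 2 * (B + 1) by have := bnd 0 (lexx _); rewrite mul0r.
have := bnd ((2 * (B + 1) + 1) / `|y|); rewrite divfK ?gt_eqF// => h1.
have := h1 (divr_ge0 _ (ltW y0)) => /(_ (addr_ge0 B0 ler01)).
by rewrite gerDl ler10.
Qed.

End NormTopology.

(** * Duality *)

Section Duality.
Variables (R : realType) (n M m q : nat) (d : 'I_n -> nat).
Variables (Nk : forall k, 'cV[R]_(d k) -> R).
Variables (C : 'M[R]_(q, \sum_k d k)) (h : 'cV[R]_q).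
Variables (theta : 'I_M -> R) (atom : 'I_M -> 'cV[R]_(\sum_k d k)).
Variables (eps : 'cV[R]_n) (alpha : R).
Variables (a : 'I_m -> 'cV[R]_(\sum_k d k)) (beta : 'I_m -> R).
Hypothesis hNk : forall k, is_norm (@Nk k).
Hypothesis heps : forall k, 0 <= eps k 0.
Hypothesis htheta : forall l, 0 <= theta l.
Hypothesis theta1 : \sum_l theta l = 1.
Hypothesis halpha : 0 < alpha < 1.
Hypothesis hatom : forall l, polyhedron C h (atom l).

Notation vec := 'cV[R]_(\sum_k d k).

(* [mu l j] is the mass sent from [atom l] with the [j]-th
   affine piece active, [y l j] is [mu l j] times its displacement. *)
Definition dual_feasible (sigma : R) (mu : 'I_M -> 'I_m -> R)
    (y : 'I_M -> 'I_m -> vec) : Prop :=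
  [/\ forall l j, 0 <= mu l j, \sum_l \sum_j mu l j = alpha * sigma,
      forall l, \sum_j mu l j <= sigma * theta l,
      forall l j e, (C *m y l j) e 0 <= mu l j * (h - C *m atom l) e 0
    & forall k, \sum_l \sum_j Nk (submxcol (y l j) k) <= sigma * eps k 0].

(** When [y l j = mu l j *: (x - atom l)], the summand is [mu l j] times the [j]-th affine piece at
    the target [x]. *)
Definition dual_value (mu : 'I_M -> 'I_m -> R) (y : 'I_M -> 'I_m -> vec) : R :=
  \sum_l \sum_j (mu l j * (beta j + dot (a j) (atom l)) + dot (a j) (y l j)).

(* The unknowns (tau, s, eta, lambda, z), where z stands for the vectors
   [A^T x - C^T eta]. *)
Definition unknown : finType :=
  (unit + 'I_M + ('I_M * 'I_m * 'I_q) + 'I_n + ('I_M * 'I_m * 'I_(\sum_k d k)))%type.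

Definition v_tau (w : unknown -> R) : R := w (inl (inl (inl (inl tt)))).
Definition v_s (w : unknown -> R) l : R := w (inl (inl (inl (inr l)))).
Definition v_eta (w : unknown -> R) l j : 'cV[R]_q :=
  \col_e w (inl (inl (inr (l, j, e)))).
Definition v_lambda (w : unknown -> R) : 'cV[R]_n := \col_k w (inl (inr k)).
Definition v_z (w : unknown -> R) l j : vec := \col_i w (inr (l, j, i)).

Definition mk_unknown (tau : R) (s : 'I_M -> R) (eta : 'I_M -> 'I_m -> 'cV[R]_q)
    (lambda : 'cV[R]_n) (z : 'I_M -> 'I_m -> vec) : {ffun unknown -> R} :=
  [ffun t : unknown => match t with
    | inl (inl (inl (inl _))) => tau
    | inl (inl (inl (inr l))) => s l
    | inl (inl (inr (l, j, e))) => eta l j e 0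
    | inl (inr k) => lambda k 0
    | inr (l, j, i) => z l j i 0
    end].

Lemma v_tau_mk tau s eta lambda z : v_tau (mk_unknown tau s eta lambda z) = tau.
Proof. by rewrite /v_tau ffunE. Qed.
Lemma v_s_mk tau s eta lambda z : v_s (mk_unknown tau s eta lambda z) =1 s.
Proof. by move=> l; rewrite /v_s ffunE. Qed.
Lemma v_eta_mk tau s eta lambda z l j :
  v_eta (mk_unknown tau s eta lambda z) l j = eta l j.
Proof. by apply/colP => e; rewrite !mxE ffunE. Qed.
Lemma v_lambda_mk tau s eta lambda z :
  v_lambda (mk_unknown tau s eta lambda z) = lambda.
Proof. by apply/colP => e; rewrite !mxE ffunE. Qed.
Lemma v_z_mk tau s eta lambda z l j :
  v_z (mk_unknown tau s eta lambda z) l j = z l j.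
Proof. by apply/colP => e; rewrite !mxE ffunE. Qed.

Lemma pairing_unknown (u w : unknown -> R) :
  pairing u w = v_tau u * v_tau w + \sum_l v_s u l * v_s w l
    + \sum_l \sum_j dot (v_eta u l j) (v_eta w l j)
    + dot (v_lambda u) (v_lambda w) + \sum_l \sum_j dot (v_z u l j) (v_z w l j).
Proof.
have triple (k : nat) (f : 'I_M * 'I_m * 'I_k -> R) :
    \sum_t f t = \sum_l \sum_j \sum_e f (l, j, e).
  by rewrite [RHS]pair_bigA [RHS]pair_bigA/=; apply: eq_bigr => -[[]].
rewrite /pairing !big_sumType/= !triple.
congr (_ + _ + _ + _ + _).
- by rewrite (big_pred1 tt)//; case.
- apply: eq_bigr => l _; apply: eq_bigr => j _; apply: eq_bigr => e _.
  by rewrite !mxE.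
- by apply: eq_bigr => k _; rewrite !mxE.
- apply: eq_bigr => l _; apply: eq_bigr => j _; apply: eq_bigr => e _.
  by rewrite !mxE.
Qed.

(* The inequalities [phi . w <= c] that follow from the constraints of the
   reformulated problem by nonnegative combination; [sigma], [mu] and [y] are the
   multipliers of the budget constraint, of the epigraph constraints and of
   [z = a - C^T eta]. *)
Definition implied : set (constr R unknown) :=
  [set p : constr R unknown | exists sigma : R, exists mu : 'I_M -> 'I_m -> R,
    exists y : 'I_M -> 'I_m -> vec,
    [/\ 0 <= sigma, forall l j, 0 <= mu l j
      & [/\ v_tau p.1 = \sum_l \sum_j mu l j - alpha * sigma,
      forall l, v_s p.1 l <= sigma * theta l - \sum_j mu l j,
      forall l j e, v_eta p.1 l j e 0 <=
        mu l j * (h - C *m atom l) e 0 - (C *m y l j) e 0,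
      forall k, v_lambda p.1 k 0 <= sigma * eps k 0
        - \sum_l \sum_j Nk (submxcol (v_z p.1 l j + y l j) k)
    & - dual_value mu y <= p.2]]].

Lemma dual_value_lin s t mu1 mu2 y1 y2 :
  dual_value (fun l j => s * mu1 l j + t * mu2 l j)
    (fun l j => s *: y1 l j + t *: y2 l j) =
  s * dual_value mu1 y1 + t * dual_value mu2 y2.
Proof.
rewrite /dual_value -sum2_lin; apply: eq_bigr => l _; apply: eq_bigr => j _.
by rewrite dotDr !dotZr; ring.
Qed.

(** The multipliers combine linearly. The only nonlinear condition is the one on [lambda], and it is
    preserved because norms are convex. *)
Lemma implied_cone : is_cone implied.
Proof.
move=> s t p1 p2 s0 t0 [sg1 [mu1 [y1 [sg10 mu10 [tau1 ps1 eta1 lam1 val1]]]]]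
  [sg2 [mu2 [y2 [sg20 mu20 [tau2 ps2 eta2 lam2 val2]]]]].
exists (s * sg1 + t * sg2), (fun l j => s * mu1 l j + t * mu2 l j).
exists (fun l j => s *: y1 l j + t *: y2 l j).
have combE u : (comb s t p1 p2).1 u = s * p1.1 u + t * p2.1 u by rewrite ffunE.
have lin (x1 x2 z1 z2 : R) : x1 <= z1 -> x2 <= z2 ->
    s * x1 + t * x2 <= s * z1 + t * z2.
  by move=> ? ?; apply: lerD; apply: ler_wpM2l.
split=> [|l j|]; [by rewrite addr_ge0// mulr_ge0|by rewrite addr_ge0// mulr_ge0|].
split.
- rewrite sum2_lin /v_tau combE -/(v_tau p1.1) -/(v_tau p2.1) tau1 tau2; ring.
- move=> l; rewrite sum_lin /v_s combE -/(v_s p1.1 l) -/(v_s p2.1 l).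
  by rewrite (le_trans (lin _ _ _ _ (ps1 l) (ps2 l)))//; lra.
- move=> l j e; rewrite mxE combE mulmxDr -!scalemxAr.
  have := lin _ _ _ _ (eta1 l j e) (eta2 l j e).
  by rewrite ![v_eta _ _ _ _ _]mxE !mxE; lra.
- move=> k; rewrite mxE combE.
  have := lin _ _ _ _ (lam1 k) (lam2 k); rewrite ![v_lambda _ _ _]mxE.
  move=> /le_trans; apply.
  suff : \sum_l \sum_j Nk (submxcol (v_z (comb s t p1 p2).1 l j
        + (s *: y1 l j + t *: y2 l j)) k) <=
      s * (\sum_l \sum_j Nk (submxcol (v_z p1.1 l j + y1 l j) k))
      + t * (\sum_l \sum_j Nk (submxcol (v_z p2.1 l j + y2 l j) k)).
    by lra.
  rewrite -sum2_lin; apply: ler_sum => l _; apply: ler_sum => j _.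
  rewrite (_ : v_z _ l j = s *: v_z p1.1 l j + t *: v_z p2.1 l j); last first.
    by apply/colP => i; rewrite !mxE combE.
  rewrite addrACA -!scalerDr [submxcol (_ *: _ + _) k]submxcolD !submxcolZ.
  exact: norm_comb.
- by rewrite dual_value_lin /=; have := lin _ _ _ _ val1 val2; lra.
Qed.

(* Adding the epigraph constraints of one piece, weighted by [alpha * theta l], to
   the budget constraint eliminates [tau], [s] and [eta]; it bounds [lambda k]
   whenever [eps k] is positive, hence also [z]. *)
Lemma implied_bounded (hm : (0 < m)%N) (phi : {ffun unknown -> R}) :
  v_tau phi = 0 -> (forall l, v_s phi l = 0) -> (forall l j, v_eta phi l j = 0) ->
  (forall k, eps k 0 = 0 -> v_lambda phi k 0 = 0 /\
     forall l j, submxcol (v_z phi l j) k = 0) ->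
  exists c, implied (phi, c).
Proof.
move=> tau0 s0 eta0 phi0.
have al0 : 0 <= alpha by case/andP: halpha => /ltW.
have N0 k u : 0 <= Nk (u : 'cV_(d k)) by apply: norm_nneg.
pose S k := `|v_lambda phi k 0| + \sum_l \sum_j Nk (submxcol (v_z phi l j) k).
have S0 k : 0 <= S k.
  by rewrite addr_ge0// sumr_ge0// => l _; apply: sumr_ge0.
(* The budget multiplier is so large that [sigma * eps k 0] dominates [S k] in each block of
   positive radius. In a block of zero radius the quotient is 0 by convention, and [S k] vanishes by
   assumption. All the mass goes to one piece, without displacement. *)
pose sigma := \sum_k S k / eps k 0.
pose mu (l : 'I_M) (j : 'I_m) := (j == Ordinal hm)%:R * (alpha * theta l * sigma).
have sg0 : 0 <= sigma by apply: sumr_ge0 => k _; rewrite divr_ge0.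
have sum_mu l : \sum_j mu l j = alpha * theta l * sigma.
  rewrite (bigD1 (Ordinal hm))//= big1 ?addr0 /mu ?eqxx ?mul1r//.
  by move=> j /negPf ->; rewrite mul0r.
exists (- dual_value mu (fun _ _ => 0)), sigma, mu, (fun _ _ => 0).
split=> //; first by move=> l j; rewrite !mulr_ge0.
split=> //=.
- rewrite tau0 (eq_bigr _ (fun l _ => sum_mu l)).
  by rewrite -mulr_suml -mulr_sumr theta1 mulr1 subrr.
- move=> l; rewrite s0 sum_mu subr_ge0 mulrC mulrCA ler_piMl ?mulr_ge0//.
  by case/andP: halpha => _ /ltW.
- move=> l j e; rewrite eta0 mulmx0 !mxE subr0 !mulr_ge0// subr_ge0.
  by have := hatom l e; rewrite mxE.
- move=> k; rewrite lerBrDr.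
  rewrite (_ : \sum_l _ = \sum_l \sum_j Nk (submxcol (v_z phi l j) k)); last first.
    by apply: eq_bigr => l _; apply: eq_bigr => j _; rewrite addr0.
  rewrite (@le_trans _ _ (S k))//; first by rewrite lerD2r ler_norm.
  have [e0|e0] := eqVneq (eps k 0) 0.
    have [l0 z0] := phi0 k e0.
    rewrite /S l0 normr0 add0r e0 mulr0 big1// => l _; rewrite big1// => j _.
    by rewrite z0 norm_zero.
  rewrite -ler_pdivrMr; last by rewrite lt_def e0 heps.
  rewrite /sigma (bigD1 k)//= lerDl sumr_ge0// => k' _.
  by rewrite divr_ge0.
Qed.


(** When all coefficients are zero, the conditions on the multipliers are those of a dual feasible
    point at scale [sg], and the negative right-hand side makes its value positive. Dividing by [sg]
    gives scale 1. *)
Lemma implied_dual p : implied p -> p.1 = [ffun=> 0] -> p.2 < 0 ->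
  exists mu y, dual_feasible 1 mu y /\ 0 < dual_value mu y.
Proof.
case: p => phi c /= [sg [mu [y [sg0 mu0 [tau ps eta lam val]]]]] phi0 c0.
move: tau ps eta lam val; rewrite /= {}phi0 => tau ps eta lam val.
have {}tau : \sum_l \sum_j mu l j = alpha * sg.
  by move: tau; rewrite /v_tau ffunE => /esym/eqP; rewrite subr_eq0 => /eqP.
have {}ps l : \sum_j mu l j <= sg * theta l.
  by have := ps l; rewrite /v_s ffunE subr_ge0.
have {}eta l j e : (C *m y l j) e 0 <= mu l j * (h - C *m atom l) e 0.
  by have := eta l j e; rewrite mxE ffunE subr_ge0.
have {}lam k : \sum_l \sum_j Nk (submxcol (y l j) k) <= sg * eps k 0.
  have := lam k; rewrite mxE ffunE subr_ge0; congr (_ <= _).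
  apply: eq_bigr => l _; apply: eq_bigr => j _; congr (Nk (submxcol _ k)).
  by apply/colP => i; rewrite !mxE ffunE add0r.
have N0 k u : 0 <= Nk (u : 'cV_(d k)) by apply: norm_nneg.
have sum2_eq0 (f : 'I_M -> 'I_m -> R) : (forall l j, 0 <= f l j) ->
    \sum_l \sum_j f l j <= 0 -> forall l j, f l j = 0.
  move=> f0 fs l j; apply/eqP; rewrite eq_le f0 andbT (le_trans _ fs)//.
  rewrite (bigD1 l)//= (bigD1 j)//= -addrA lerDl addr_ge0 ?sumr_ge0//.
  by move=> l' _; rewrite sumr_ge0.
have val0 : 0 < dual_value mu y by lra.
(* At [sg = 0] the total mass and all transport costs vanish, so [mu] and [y] are zero,
   contradicting the positive value. *)
have [sgE|sgN] := eqVneq sg 0.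
  have muE : forall l j, mu l j = 0 by apply: sum2_eq0 => //; rewrite tau sgE mulr0.
  have yE l j : y l j = 0.
    rewrite -[LHS]submxcolK -[RHS]submxcolK; congr (\mxcol_k _).
    apply: functional_extensionality_dep => k; rewrite submxcol0.
    apply: (norm_eq0 (hNk k)).
    apply: (@sum2_eq0 (fun l j => Nk (submxcol (y l j) k))) => //.
    by rewrite (le_trans (lam k))// sgE mul0r.
  move: val0; rewrite /dual_value big1 ?ltxx// => l _; rewrite big1// => j _.
  by rewrite muE yE mul0r dot0r addr0.
have sgP : 0 < sg by rewrite lt_def sgN.
have isg0 : 0 < sg^-1 by rewrite invr_gt0.
have cancel x1 x2 : x1 <= sg * x2 -> sg^-1 * x1 <= x2.
  by move=> x12; rewrite mulrC ler_pdivrMr// mulrC.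
exists (fun l j => sg^-1 * mu l j), (fun l j => sg^-1 *: y l j); split; first split.
- by move=> l j; rewrite mulr_ge0// ltW.
- rewrite (eq_bigr (fun l => sg^-1 * \sum_j mu l j)) => [|l _]; last first.
    by rewrite mulr_sumr.
  by rewrite -mulr_sumr tau mulr1 mulrCA mulVf ?mulr1.
- by move=> l; rewrite -mulr_sumr mul1r cancel.
- by move=> l j e; rewrite -scalemxAr mxE -mulrA ler_wpM2l// ltW.
- move=> k; rewrite mul1r (le_trans _ (cancel _ _ (lam k)))// mulr_sumr.
  apply: ler_sum => l _; rewrite mulr_sumr; apply: ler_sum => j _.
  by rewrite submxcolZ (norm_scale (hNk k)) gtr0_norm.
- rewrite (_ : dual_value _ _ = sg^-1 * dual_value mu y) ?mulr_gt0//.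
  rewrite /dual_value mulr_sumr; apply: eq_bigr => l _.
  by rewrite mulr_sumr; apply: eq_bigr => j _; rewrite dotZr; ring.
Qed.

(** * The constraints of the reformulated problem as linear inequalities *)

Definition at_pair (V : nmodType) (l : 'I_M) (j : 'I_m) (v : V) l' j' : V :=
  if (l' == l) && (j' == j) then v else 0.

Lemma at_pairE (V : nmodType) l j (v : V) : at_pair l j v l j = v.
Proof. by rewrite /at_pair !eqxx. Qed.

Lemma sum_at_pair (V : nmodType) l j (v : V) (f : 'I_M -> 'I_m -> V -> R) :
  (forall l j, f l j 0 = 0) ->
  \sum_l' \sum_j' f l' j' (at_pair l j v l' j') = f l j v.
Proof.
move=> f0; rewrite (bigD1 l)//= (bigD1 j)//= at_pairE.
rewrite big1 => [|j' /negPf jj']; last by rewrite /at_pair jj' andbF f0.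
rewrite big1 ?addr0// => l' /negPf ll'; rewrite big1// => j' _.
by rewrite /at_pair ll' f0.
Qed.

Definition budget_constr : constr R unknown :=
  (mk_unknown (- alpha) theta (fun _ _ => 0) eps (fun _ _ => 0), 0).

(** Moving [C] to the other side of the inner product collects the terms in [eta] into the slack
    vector [h - C *m atom] of the atom. *)
Definition epigraph_constr (t : 'I_M * 'I_m) : constr R unknown :=
  (mk_unknown 1 (fun l => - (l == t.1)%:R)
     (at_pair t.1 t.2 (h - C *m atom t.1)) 0 (fun _ _ => 0),
   - (beta t.2 + dot (a t.2) (atom t.1))).

(** One half of [z = a - C^T eta], tested in the direction [t.2]; two opposite directions give
    equality along that direction. *)
Definition link_constr (t : 'I_M * 'I_m * vec) : constr R unknown :=
  (mk_unknown 0 (fun=> 0) (at_pair t.1.1 t.1.2 (- (C *m t.2))) 0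
     (at_pair t.1.1 t.1.2 (- t.2)), - dot (a t.1.2) t.2).

Definition s_constr (l : 'I_M) : constr R unknown :=
  (mk_unknown 0 (fun l' => - (l' == l)%:R) (fun _ _ => 0) 0 (fun _ _ => 0), 0).

Definition eta_constr (t : 'I_M * 'I_m * 'I_q) : constr R unknown :=
  (mk_unknown 0 (fun=> 0) (at_pair t.1.1 t.1.2 (- delta_mx t.2 0)) 0
     (fun _ _ => 0), 0).

Lemma pairing_mk tau s eta lambda z w :
  pairing (mk_unknown tau s eta lambda z) w = tau * v_tau w + \sum_l s l * v_s w l
    + \sum_l \sum_j dot (eta l j) (v_eta w l j)
    + dot lambda (v_lambda w) + \sum_l \sum_j dot (z l j) (v_z w l j).
Proof.
rewrite pairing_unknown v_tau_mk v_lambda_mk; congr (_ + _ + _ + _ + _).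
- by apply: eq_bigr => l _; rewrite v_s_mk.
- by apply: eq_bigr => l _; apply: eq_bigr => j _; rewrite v_eta_mk.
- by apply: eq_bigr => l _; apply: eq_bigr => j _; rewrite v_z_mk.
Qed.

Lemma sum_dot_at_pair k l j (v : 'cV[R]_k) (f : 'I_M -> 'I_m -> 'cV[R]_k) :
  \sum_l' \sum_j' dot (at_pair l j v l' j') (f l' j') = dot v (f l j).
Proof.
by rewrite (@sum_at_pair _ _ _ _ (fun l j v => dot v (f l j))) => *; rewrite ?dot0l.
Qed.

Lemma sum_dot0 k (f : 'I_M -> 'I_m -> 'cV[R]_k) :
  \sum_l' \sum_j' dot 0 (f l' j') = 0.
Proof. by rewrite big1// => l _; rewrite big1// => j _; rewrite dot0l. Qed.

Lemma sum_neg_unit l (f : 'I_M -> R) : \sum_l' - (l' == l)%:R * f l' = - f l.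
Proof.
rewrite (bigD1 l)//= eqxx mulN1r big1 ?addr0// => l' /negPf ->.
by rewrite oppr0 mul0r.
Qed.

Lemma sum_zero (f : 'I_M -> R) : \sum_l' 0 * f l' = 0.
Proof. by rewrite big1// => l _; rewrite mul0r. Qed.

Definition pairing_simp :=
  (pairing_mk, sum_dot_at_pair, sum_dot0, sum_neg_unit, sum_zero, dot0l).

Lemma satisfies_budget w : satisfies w budget_constr <->
  dot (v_lambda w) eps + \sum_l theta l * v_s w l <= v_tau w * alpha.
Proof.
rewrite /satisfies !pairing_simp (dotC eps).
by rewrite !addr0 mulNr -addrA addrC subr_le0 addrC mulrC.
Qed.

Lemma satisfies_s w l : satisfies w (s_constr l) <-> 0 <= v_s w l.
Proof. by rewrite /satisfies !pairing_simp /=; split=> h0; lra. Qed.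

Lemma satisfies_eta w t : satisfies w (eta_constr t) <->
  0 <= v_eta w t.1.1 t.1.2 t.2 0.
Proof.
rewrite /satisfies !pairing_simp dotNl dotC dot_delta /=.
by split=> h0; lra.
Qed.

Lemma satisfies_epigraph w t : satisfies w (epigraph_constr t) <->
  v_tau w - v_s w t.1 + dot (h - C *m atom t.1) (v_eta w t.1 t.2) <=
  - (beta t.2 + dot (a t.2) (atom t.1)).
Proof. by rewrite /satisfies !pairing_simp /=; split=> h0; lra. Qed.

Lemma satisfies_link w t : satisfies w (link_constr t) <->
  dot (a t.1.2) t.2 <=
  dot (C^T *m v_eta w t.1.1 t.1.2 + v_z w t.1.1 t.1.2) t.2.
Proof.
rewrite /satisfies !pairing_simp dotDl dot_tr !dotNl /= (dotC t.2) (dotC (C *m _)).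
by split=> h0; lra.
Qed.

(** These are the inequalities obtained with zero multipliers: consequences of the sign constraints
    and of the dual norm constraints alone. *)
Lemma implied_homogeneous tau s (eta : 'I_M -> 'I_m -> 'cV[R]_q)
    (lambda : 'cV[R]_n) (z : 'I_M -> 'I_m -> vec) c :
  tau = 0 -> (forall l, s l <= 0) -> (forall l j e, eta l j e 0 <= 0) ->
  (forall k, lambda k 0 + \sum_l \sum_j Nk (submxcol (z l j) k) <= 0) ->
  0 <= c -> implied (mk_unknown tau s eta lambda z, c).
Proof.
move=> -> s0 eta0 lam0 c0; exists 0, (fun _ _ => 0), (fun _ _ => 0).
have sum0 (I : finType) : \sum_(i : I) (0 : R) = 0 by rewrite big1.
split=> //; split.
- by rewrite v_tau_mk mulr0 subr0 big1// => l _; rewrite sum0.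
- by move=> l; rewrite v_s_mk mul0r sum0 subr0.
- by move=> l j e; rewrite v_eta_mk mul0r mulmx0 mxE subr0.
- move=> k; rewrite v_lambda_mk mul0r sub0r -subr_le0 opprK.
  rewrite (_ : \sum_l \sum_j _ = \sum_l \sum_j Nk (submxcol (z l j) k))//.
  by apply: eq_bigr => l _; apply: eq_bigr => j _; rewrite v_z_mk addr0.
- rewrite /dual_value big1 ?oppr0// => l _; rewrite big1// => j _.
  by rewrite mul0r dot0r addr0.
Qed.

Lemma sum_norm0 k : \sum_(l < M) \sum_(j < m) Nk (submxcol (0 : vec) k) = 0.
Proof.
by rewrite big1// => l _; rewrite big1// => j _; rewrite submxcol0 norm_zero.
Qed.

(** The multiplier of the constraint itself is 1 and the others are 0. The same choice works for the
    epigraph constraints, and for the link constraints [y] is the tested direction. *)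
Lemma implied_budget : implied budget_constr.
Proof.
exists 1, (fun _ _ => 0), (fun _ _ => 0).
have sum0 (I : finType) : \sum_(i : I) (0 : R) = 0 by rewrite big1.
split=> //; split.
- by rewrite v_tau_mk mulr1 big1 ?sub0r// => l _; rewrite sum0.
- by move=> l; rewrite v_s_mk mul1r sum0 subr0.
- by move=> l j e; rewrite v_eta_mk mul0r mulmx0 mxE subr0.
- move=> k; rewrite v_lambda_mk mul1r.
  rewrite (_ : \sum_l \sum_j _ = 0) ?subr0//.
  apply: etrans (sum_norm0 k).
  by apply: eq_bigr => l _; apply: eq_bigr => j _; rewrite v_z_mk addr0.
- rewrite /dual_value big1 ?oppr0// => l _; rewrite big1// => j _.
  by rewrite mul0r dot0r addr0.
Qed.

Lemma implied_epigraph t : implied (epigraph_constr t).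
Proof.
exists 0, (at_pair t.1 t.2 1), (fun _ _ => 0).
split=> //; first by move=> l j; rewrite /at_pair; case: ifP.
split.
- by rewrite v_tau_mk (@sum_at_pair _ _ _ _ (fun _ _ v => v))// mulr0 subr0.
- move=> l; rewrite v_s_mk mul0r sub0r lerN2 /at_pair; case: (l == t.1) => /=.
    by rewrite (bigD1 t.2)//= eqxx big1 ?addr0// => j /negPf ->.
  by rewrite big1.
- move=> l j e; rewrite v_eta_mk /at_pair mulmx0 [(0 : matrix _ _ _) _ _]mxE subr0.
  by case: ifPn => [/andP[/eqP -> _]|_]; rewrite ?mul1r// mul0r mxE.
- move=> k; rewrite v_lambda_mk mul0r mxE.
  rewrite (_ : \sum_l \sum_j _ = 0) ?subr0//.
  apply: etrans (sum_norm0 k).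
  by apply: eq_bigr => l _; apply: eq_bigr => j _; rewrite v_z_mk addr0.
- rewrite lerN2 /dual_value (eq_bigr (fun l => \sum_j
      at_pair t.1 t.2 1 l j * (beta j + dot (a j) (atom l)))); last first.
    by move=> l _; apply: eq_bigr => j _; rewrite dot0r addr0.
  rewrite (@sum_at_pair _ _ _ _
    (fun l j v => v * (beta j + dot (a j) (atom l)))) ?mul1r//.
  by move=> l j; rewrite mul0r.
Qed.

Lemma implied_link t : implied (link_constr t).
Proof.
exists 0, (fun _ _ => 0), (at_pair t.1.1 t.1.2 t.2).
have sum0 (I : finType) : \sum_(i : I) (0 : R) = 0 by rewrite big1.
split=> //; split.
- by rewrite v_tau_mk mulr0 subr0 big1// => l _; rewrite sum0.
- by move=> l; rewrite v_s_mk mul0r sum0 subr0.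
- move=> l j e; rewrite v_eta_mk mul0r sub0r /at_pair.
  by case: ifP => _; rewrite ?mulmx0 !mxE ?oppr0.
- move=> k; rewrite v_lambda_mk mul0r mxE.
  rewrite (_ : \sum_l \sum_j _ = 0) ?subr0//.
  apply: etrans (sum_norm0 k).
  apply: eq_bigr => l _; apply: eq_bigr => j _; rewrite v_z_mk /at_pair.
  by case: ifP; rewrite ?addNr ?addr0.
- rewrite lerN2 /dual_value (eq_bigr (fun l => \sum_j
      dot (a j) (at_pair t.1.1 t.1.2 t.2 l j))); last first.
    by move=> l _; apply: eq_bigr => j _; rewrite mul0r add0r.
  rewrite (@sum_at_pair _ _ _ _ (fun l j v => dot (a j) v))// => l j.
  exact: dot0r.
Qed.

Lemma implied_s l : implied (s_constr l).
Proof.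
apply: implied_homogeneous => // [l' j e|k]; first by rewrite mxE.
by rewrite sum_norm0 addr0 mxE.
Qed.

Lemma implied_eta t : implied (eta_constr t).
Proof.
apply: implied_homogeneous => // [l' j e|k].
  by rewrite /at_pair; case: ifP => _; rewrite !mxE ?oppr_le0.
by rewrite sum_norm0 addr0 mxE.
Qed.

(** The dual norm constraint is split into one linear inequality per vector [u]; this family makes
    the system infinite. *)
Definition norm_constr (l : 'I_M) (j : 'I_m) k (u : 'cV[R]_(d k)) :
    constr R unknown :=
  (mk_unknown 0 (fun=> 0) (fun _ _ => 0) (- Nk u *: delta_mx k 0)
     (at_pair l j (block_embed u)), 0).

Lemma implied_norm l j k (u : 'cV[R]_(d k)) : implied (norm_constr l j u).
Proof.
apply: implied_homogeneous => // [l' j' e|k']; first by rewrite mxE.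
rewrite (@sum_at_pair _ _ _ _ (fun _ _ v => Nk (submxcol v k'))); last first.
  by move=> *; rewrite submxcol0 norm_zero.
rewrite !mxE andbT; have [->|kk'] := eqVneq k' k.
  by rewrite block_embedE mulr1 addNr.
by rewrite block_embed_neq 1?eq_sym// (norm_zero (hNk k')) mulr0 addr0.
Qed.

Lemma satisfies_norm w l j k (u : 'cV[R]_(d k)) :
  satisfies w (norm_constr l j u) <->
  dot (submxcol (v_z w l j) k) u <= Nk u * v_lambda w k 0.
Proof.
rewrite /satisfies !pairing_simp dotZl (dotC (delta_mx _ _)) dot_delta.
rewrite (dotC (block_embed u)) dot_block_embed /=.
by split=> h0; lra.
Qed.

Definition lambda_constr k : constr R unknown :=
  (mk_unknown 0 (fun=> 0) (fun _ _ => 0) (- delta_mx k 0) (fun _ _ => 0), 0).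

Lemma implied_lambda k : implied (lambda_constr k).
Proof.
apply: implied_homogeneous => // [l' j' e|k']; first by rewrite mxE.
by rewrite sum_norm0 addr0 !mxE oppr_le0.
Qed.

Lemma satisfies_lambda w k : satisfies w (lambda_constr k) <->
  0 <= v_lambda w k 0.
Proof.
rewrite /satisfies !pairing_simp dotNl (dotC (delta_mx _ _)) dot_delta /=.
by split=> h0; lra.
Qed.

(** The unknowns that implied inequalities bound from both sides: [lambda] and [z] in the blocks of
    positive radius. The others are left to Fourier-Motzkin elimination. *)
Definition a_priori (t : unknown) : bool :=
  match t with
  | inl (inr k) => 0 < eps k 0
  | inr (_, _, i) => 0 < eps (tagnat.sig1 i) 0
  | _ => false
  end.

Lemma submxcol_sig (v : vec) i :
  submxcol v (tagnat.sig1 i) (tagnat.sig2 i) 0 = v i 0.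
Proof. by rewrite mxE tagnat.sig2K. Qed.

Lemma implied_a_priori (hm : (0 < m)%N) (t : unknown) (b : bool) :
  a_priori t -> exists c, implied (signed_unit R b t, c).
Proof.
move=> ht; apply: implied_bounded => //.
- rewrite /v_tau ffunE; case: eqP => [tE|]; rewrite ?mulr0//.
  by move: ht; rewrite -tE.
- move=> l; rewrite /v_s ffunE; case: eqP => [tE|]; rewrite ?mulr0//.
  by move: ht; rewrite -tE.
- move=> l j; apply/colP => e; rewrite !mxE ffunE.
  by case: eqP => [tE|]; rewrite ?mulr0//; move: ht; rewrite -tE.
- move=> k ek; split.
    rewrite mxE ffunE; case: eqP => [tE|]; rewrite ?mulr0//.
    by move: ht; rewrite -tE /= ek ltxx.
  move=> l j; apply/colP => i; rewrite !mxE ffunE.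
  case: eqP => [tE|]; rewrite ?mulr0//.
  by move: ht; rewrite -tE /= tagnat.Rank1K ek ltxx.
Qed.

(** Farkas' alternative for fixed [x]: an absurd implied inequality would yield a dual feasible
    point of positive value, so the semi-infinite system has a solution. *)
Lemma lagrange_duality (hm : (0 < m)%N)
    (hdual : forall k (z : 'cV[R]_(d k)), exists c, (dual_norm (@Nk k) z <= c%:E)%E) :
  (forall mu y, dual_feasible 1 mu y -> dual_value mu y <= 0) ->
  exists (tau : R) (lambda : 'cV[R]_n) (s : 'I_M -> R)
    (eta : 'I_M -> 'I_m -> 'cV[R]_q),
  [/\ dot lambda eps + \sum_l theta l * s l <= tau * alpha,
      forall l j, beta j + tau + dot (a j - C^T *m eta l j) (atom l)
        + dot (eta l j) h <= s l,
      forall l j k, (dual_norm (@Nk k) (submxcol (a j - C^T *m eta l j) k)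
        <= (lambda k 0)%:E)%E
    & forall l j, 0 <= s l /\ forall e, 0 <= eta l j e 0].
Proof.
move=> dual_le0.
(* Signed basis vectors suffice to force [z = a - C^T eta] and keep the list [F] finite. In the
   blocks of zero radius [z] stays unlinked. *)
pose link (t : 'I_M * 'I_m * (bool * 'I_(\sum_k d k))%type) : constr R unknown :=
  link_constr (t.1, (-1) ^+ t.2.1 *: delta_mx t.2.2 0).
pose linked (t : 'I_M * 'I_m * (bool * 'I_(\sum_k d k))%type) :=
  0 < eps (tagnat.sig1 t.2.2) 0.
pose F := budget_constr :: [seq epigraph_constr t | t : 'I_M * 'I_m] ++
  [seq link t | t in linked] ++
  [seq s_constr l | l : 'I_M] ++ [seq eta_constr t | t : 'I_M * 'I_m * 'I_q].
have [|t b|p ip p0|w [Fw Kw]] := semi_infinite_farkas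
    (F := F) (js := [seq t <- enum unknown | a_priori t]) implied_cone.
- move=> p; rewrite inE !mem_cat => /predU1P[->|]; first exact: implied_budget.
  move=> /or4P[] /mapP[t _ ->].
  + exact: implied_epigraph.
  + exact: implied_link.
  + exact: implied_s.
  + exact: implied_eta.
- by rewrite mem_filter => /andP[ht _]; exact: implied_a_priori.
- rewrite leNgt; apply/negP => c0.
  have [mu [y [feas]]] := implied_dual ip p0 c0.
  by rewrite ltNge dual_le0.
have budgetP : satisfies w budget_constr by apply: Fw; rewrite mem_head.
have epigraphP t : satisfies w (epigraph_constr t).
  by apply: Fw; rewrite inE mem_cat map_f ?mem_enum ?orbT.
have linkP t : linked t -> satisfies w (link t).
  move=> ht; apply: Fw; rewrite inE !mem_cat.
  by rewrite [link t \in [seq link _ | _ in linked]]map_f ?mem_enum ?orbT.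
have sP l : satisfies w (s_constr l).
  apply: Fw; rewrite inE !mem_cat.
  by rewrite [_ \in [seq s_constr _ | _ : _]]map_f ?mem_enum ?orbT.
have etaP t : satisfies w (eta_constr t).
  apply: Fw; rewrite inE !mem_cat.
  by rewrite [_ \in [seq eta_constr _ | _ : _]]map_f ?mem_enum ?orbT.
have js0 t : t \notin [seq t <- enum unknown | a_priori t] -> ~~ a_priori t.
  by rewrite mem_filter mem_enum andbT.
have z_block l j k : 0 < eps k 0 ->
    submxcol (v_z w l j) k = submxcol (a j - C^T *m v_eta w l j) k.
  move=> ek; apply/colP => i.
  have lk b : linked (l, j, (b, tagnat.Rank k i)) by rewrite /linked tagnat.Rank1K.
  have /satisfies_link/= := linkP _ (lk false).
  have /satisfies_link/= := linkP _ (lk true).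
  rewrite !dotZr !dot_delta expr0 expr1.
  rewrite [submxcol _ k i 0]mxE [RHS]mxE [in RHS]mxE [(- _ : matrix _ _ _) _ _]mxE.
  rewrite [(_ + _ : matrix _ _ _) _ _]mxE.
  by move=> h1 h2; lra.
(* For a block of positive radius these constraints involve only a priori bounded unknowns, so they
   are among those that the solution [w] satisfies. *)
have normP l j k (u : 'cV_(d k)) : 0 < eps k 0 ->
    dot (submxcol (v_z w l j) k) u <= Nk u * v_lambda w k 0.
  move=> ek; apply/satisfies_norm; apply: Kw; first exact: implied_norm.
  move=> t /js0; rewrite ffunE; case: t => [[[[]|[[? ?] ?]]|k']|[[l' j'] i]] //=.
  - by rewrite mxE.
  - move=> ek'; rewrite !mxE andbT (_ : (k' == k) = false) ?mulr0//.
    by apply: contraNF ek' => /eqP ->.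
  - move=> ei; rewrite /at_pair; case: ifP => _; last by rewrite mxE.
    rewrite -submxcol_sig block_embed_neq ?mxE//.
    by apply: contraNneq ei => <-.
have lamP k : 0 < eps k 0 -> 0 <= v_lambda w k 0.
  move=> ek; apply/satisfies_lambda; apply: Kw; first exact: implied_lambda.
  move=> t /js0; rewrite ffunE; case: t => [[[[]|[[? ?] ?]]|k']|[[l' j'] i]] //=.
  - by rewrite mxE.
  - move=> ek'; rewrite !mxE andbT (_ : (k' == k) = false) ?oppr0//.
    by apply: contraNF ek' => /eqP ->.
  - by rewrite mxE.
pose eta := v_eta w.
have [B hB] : exists B : forall k, 'I_M -> 'I_m -> R, forall k l j,
    (dual_norm (@Nk k) (submxcol (a j - C^T *m eta l j) k) <= (B k l j)%:E)%E.
  exists (fun k l j =>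
    projT1 (cid (hdual k (submxcol (a j - C^T *m eta l j) k)))) => k l j.
  by case: cid.
(* In a block of zero radius [lambda] does not enter the budget, so it may be any common bound of
   the finitely many dual norms. *)
pose lambda : 'cV[R]_n := \col_k
  if 0 < eps k 0 then v_lambda w k 0 else \sum_l \sum_j `|B k l j|.
exists (v_tau w), lambda, (v_s w), eta; split.
- rewrite (_ : dot lambda eps = dot (v_lambda w) eps); first exact/satisfies_budget.
  apply: eq_bigr => k _; rewrite mxE; case: ltP => // e0.
  by rewrite (_ : eps k 0 = 0) ?mulr0//; apply/eqP; rewrite eq_le e0 heps.
- move=> l j; have /satisfies_epigraph/= := epigraphP (l, j).
  by rewrite !dotBl dot_tr (dotC (eta l j) h) -/eta (dotC (C *m _)) => h1; lra.
- move=> l j k; rewrite [lambda k 0]mxE; case: ltP => [ek|_]; last first.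
    rewrite (le_trans (hB k l j))// lee_fin (bigD1 l)//= (bigD1 j)//=.
    rewrite -addrA (le_trans (ler_norm _))// lerDl addr_ge0 ?sumr_ge0//.
    by move=> l' _; rewrite sumr_ge0.
  apply: ge_ereal_sup => _ [u /= Nu1 <-]; rewrite lee_fin -z_block//.
  by rewrite (le_trans (normP _ _ _ _ ek))// ler_piMl// lamP.
- move=> l j; split; first exact/satisfies_s.
  by move=> e; have /satisfies_eta := etaP (l, j, e).
Qed.

End Duality.

(** * Borel measures with finite support, Jensen inequality *)

Section Borel.
Variable R : realType.

Lemma measurable_gen (T U : pointedType) (G : set (set T)) (H : set (set U))
    (f : T -> U) : (forall B, H B -> G (f @^-1` B)) ->
  measurable_fun [set: g_sigma_algebraType G]
    (f : g_sigma_algebraType G -> g_sigma_algebraType H).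
Proof.
move=> HG; apply: (@measurability _ _ (g_sigma_algebraType G)
  (g_sigma_algebraType H) setT f H) => //.
by move=> _ [B HB <-]; rewrite setTI; apply: sub_sigma_algebra; exact: HG.
Qed.

Lemma measurable_genR (T : pointedType) (G : set (set T)) (f : T -> R) :
  (forall B, open B -> G (f @^-1` B)) ->
  measurable_fun [set: g_sigma_algebraType G] (f : g_sigma_algebraType G -> R).
Proof.
move=> oG; apply: (measurability _ (RGenOpens.measurableE R)) => //.
move=> _ [_ [a [b ->]] <-]; rewrite setTI; apply: sub_sigma_algebra.
exact/oG/interval_open.
Qed.

Lemma measurable_genC (T : pointedType) (G : set (set T)) (B : set T) :
  G (~` B) -> measurable (B : set (g_sigma_algebraType G)).
Proof.
by move=> GB; rewrite -[B]setCK; apply: measurableC; exact: sub_sigma_algebra.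
Qed.

End Borel.

Section Discrete.
Context (R : realType) (disp : measure_display) (T : measurableType disp).
Variable s : seq (R * T).

Let atom_ k := nth (0, point) s k.

(** Absolute values make this a measure for every list of weights; they change nothing when the
    weights are nonnegative. *)
Definition discrete_measure :=
  msum (fun k => mscale (NngNum (normr_ge0 (atom_ k).1)) \d_((atom_ k).2)) (size s).

HB.instance Definition _ := Measure.on discrete_measure.

Lemma discrete_measureE A :
  discrete_measure A = (\sum_(t <- s) `|t.1|%:E * \d_(t.2) A)%E.
Proof.
rewrite /discrete_measure /msum (big_nth (0, point)) big_mkord.
by apply: eq_bigr => k _.
Qed.

Lemma integral_discrete_measure D (f : T -> \bar R) : measurable D ->
  measurable_fun D f -> (forall x, D x -> (0 <= f x)%E) ->
  (\int[discrete_measure]_(x in D) f x =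
    \sum_(t <- s) `|t.1|%:E * (\d_(t.2) D * f t.2))%E.
Proof.
move=> mD mf f0; rewrite /discrete_measure ge0_integral_measure_sum//.
rewrite (big_nth (0, point)) big_mkord; apply: eq_bigr => k _.
by rewrite ge0_integral_mscale// integral_dirac.
Qed.

End Discrete.

Section DiscreteProbability.
Context (R : realType) (disp : measure_display) (T : measurableType disp).
Variables (I : finType) (w : I -> R) (x_ : I -> T).
Hypothesis w0 : forall i, 0 <= w i.

Let s := [seq (w i, x_ i) | i : I].

Let big_s (f : R * T -> \bar R) :
  (\sum_(t <- s) f t = \sum_i f (w i, x_ i))%E.
Proof. by rewrite /s big_map big_enum. Qed.

Lemma discrete_probability : \sum_i w i = 1 -> exists P : probability T R,
  forall A, P A = (\sum_i (w i)%:E * \d_(x_ i) A)%E.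
Proof.
move=> w1; pose mu : measure T R := discrete_measure s.
have muE A : mu A = (\sum_i (w i)%:E * \d_(x_ i) A)%E.
  rewrite [LHS]discrete_measureE big_s; apply: eq_bigr => i _ /=.
  by rewrite ger0_norm.
have mu1 : mu setT = 1%E.
  rewrite muE; under eq_bigr do rewrite diracT mule1.
  by rewrite sumEFin w1.
(* Normalisation only provides the type of probabilities: the total mass is already 1, so the
   default Dirac mass never occurs. *)
exists (mnormalize mu \d_point) => A; rewrite [LHS](_ : _ =
  if (mu setT == 0) || (mu setT == +oo) then \d_point A
  else mu A * (fine (mu setT))^-1%:E)%E; last first.
  by rewrite /=/mnormalize; case: ifP.
by rewrite mu1 onee_eq0/= invr1 mule1 muE.
Qed.

Lemma integral_discrete (P : measure T R) D (f : T -> \bar R) :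
  (forall A, measurable A -> P A = (\sum_i (w i)%:E * \d_(x_ i) A)%E) ->
  measurable D -> measurable_fun D f -> (forall x, D x -> (0 <= f x)%E) ->
  (forall i, D (x_ i)) ->
  (\int[P]_(x in D) f x = \sum_i (w i)%:E * f (x_ i))%E.
Proof.
move=> PE mD mf f0 xD.
rewrite (eq_measure_integral (discrete_measure s)) => [|A mA _]; last first.
  rewrite [RHS]discrete_measureE big_s PE//; apply: eq_bigr => i _ /=.
  by rewrite ger0_norm.
rewrite integral_discrete_measure// big_s; apply: eq_bigr => i _ /=.
by rewrite ger0_norm// diracE mem_set// mul1e.
Qed.

End DiscreteProbability.

Section Jensen.
Context (R : realType) (disp : measure_display) (T : measurableType disp).
Variable P : probability T R.

Lemma integral_subr (D : set T) (g : T -> R) (c : R) : measurable D -> P D = 1%E ->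
  measurable_fun D g -> (forall x, D x -> 0 <= g x) ->
  (\int[P]_(x in D) (g x)%:E < +oo)%E ->
  (\int[P]_(x in D) (g x - c)%:E = \int[P]_(x in D) (g x)%:E - c%:E)%E.
Proof.
move=> mD PD mg g0 gfin.
rewrite integralB_EFin//.
- by rewrite (integral_cst P mD c%:E) [X in (_ * X)%E]PD mule1.
- apply/integrableP; split; first exact/measurable_EFinP.
  rewrite (eq_integral (fun x => (g x)%:E))// => x; rewrite inE => Dx.
  by rewrite /= ger0_norm// g0.
- by apply: finite_measure_integrable_cst.
Qed.

(* Jensen's inequality for [t `^ p], from Young's inequality
   [t * delta `^ (p - 1) <= t `^ p / p + delta `^ p * (1 - p^-1)]. *)
Lemma integral_le_powR (D : set T) (g : T -> R) (p e : R) : 1 <= p -> 0 <= e ->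
  measurable D -> P D = 1%E -> measurable_fun D g -> (forall x, D x -> 0 <= g x) ->
  (\int[P]_(x in D) (g x `^ p)%:E <= (e `^ p)%:E)%E ->
  (\int[P]_(x in D) (g x)%:E <= e%:E)%E.
Proof.
rewrite le_eqVlt => /predU1P[<-|p1] e0 mD PD mg g0 h.
  rewrite powRr1// in h; rewrite (le_trans _ h)// le_eqVlt; apply/orP; left.
  by apply/eqP; apply: eq_integral => x; rewrite inE => Dx; rewrite powRr1 ?g0.
have p0 : 0 < p by rewrite (lt_trans _ p1).
(* Young's inequality is applied with [delta = e + eta] instead of [e], so that [delta] is positive
   even for [e = 0]. *)
apply/lee_addgt0Pr => eta eta0; rewrite -EFinD.
set delta := e + eta; have de0 : 0 < delta by rewrite ltr_wpDl.
have pm1 : 0 < p - 1 by rewrite subr_gt0.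
pose q := p / (p - 1).
have q0 : 0 < q by rewrite divr_gt0.
have pq : p^-1 + q^-1 = 1 by rewrite /q invf_div; field; rewrite gt_eqF.
have young x : D x -> g x * delta `^ (p - 1) <= g x `^ p / p + delta `^ p / q.
  move=> Dx; have := @conjugate_powR _ (g x) (delta `^ (p - 1)) p q (g0 x Dx)
    (powR_ge0 _ _) p0 q0 pq.
  by rewrite -powRrM /q mulrCA divff ?mulr1// gt_eqF.
have dp0 : 0 < delta `^ (p - 1) by apply: powR_gt0.
have mgp : measurable_fun D (fun x => g x `^ p).
  by apply: (measurableT_comp (measurable_powR p)).
rewrite -(@lee_pmul2l _ (delta `^ (p - 1))%:E)//.
rewrite -ge0_integralZl_EFin//; [|exact/measurable_EFinP|exact: ltW].
apply: (@le_trans _ _ (\int[P]_(x in D) ((p^-1)%:E * (g x `^ p)%:E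
   + (delta `^ p / q)%:E))%E).
  apply: ge0_le_integral => //.
  - by move=> x Dx; rewrite /= lee_fin mulr_ge0 ?g0// ltW.
  - by apply: measurable_funeM; exact/measurable_EFinP.
  - apply: emeasurable_funD => //.
    by apply: measurable_funeM; exact/measurable_EFinP.
  - move=> x Dx; rewrite -!EFinM -EFinD lee_fin mulrC (mulrC p^-1).
    exact: young.
rewrite ge0_integralD//; last 3 first.
- by move=> x Dx; rewrite /= lee_fin mulr_ge0 ?powR_ge0// invr_ge0 ltW.
- by apply: measurable_funeM; exact/measurable_EFinP.
- by move=> x Dx; rewrite lee_fin divr_ge0 ?powR_ge0// ltW.
rewrite ge0_integralZl_EFin//; last 3 first.
- by move=> x Dx; rewrite lee_fin powR_ge0.
- exact/measurable_EFinP.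
- by rewrite invr_ge0 ltW.
rewrite (integral_cst P mD) [X in (_ + _ * X)%E]PD mule1.
apply: (@le_trans _ _ ((p^-1)%:E * (delta `^ p)%:E + (delta `^ p / q)%:E)%E).
  rewrite leeD2r// lee_pmul2l// ?lte_fin ?invr_gt0// (le_trans h)// lee_fin.
  by rewrite ge0_ler_powR// ?nnegrE ?(ltW p0)// ?(ltW de0)// lerDl ltW.
rewrite -!EFinM -EFinD lee_fin mulrC -mulrDr pq mulr1.
by rewrite -[X in _ `^ _ * X](powRr1 (ltW de0)) -powRD ?addrNK// gt_eqF.
Qed.

End Jensen.

Lemma ge0_integral_marginal (R : realType) (d1 d2 : measure_display)
    (T1 : measurableType d1) (T2 : measurableType d2) (mu : {measure set T1 -> \bar R})
    (nu : {measure set T2 -> \bar R}) (phi : T1 -> T2) D (f : T2 -> \bar R) :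
  measurable_fun [set: T1] phi ->
  (forall B, measurable B -> mu (phi @^-1` B) = nu B) ->
  measurable D -> measurable_fun D f -> (forall y, D y -> (0 <= f y)%E) ->
  (\int[nu]_(y in D) f y = \int[mu]_(x in phi @^-1` D) f (phi x))%E.
Proof.
move=> mphi munu mD mf f0.
rewrite -(ge0_integral_pushforward mphi mu mD mf) => [|y]; last first.
  by rewrite inE; exact: f0.
by apply: eq_measure_integral => B mB _; rewrite /= /pushforward munu.
Qed.

(** * Transport plans *)

Section MeasurableFunctions.
Variable R : realType.

Lemma measurable_bigmax (disp : measure_display) (T : measurableType disp)
    (I : Type) (r : seq I) (g : T -> R) (F : I -> T -> R) :
  measurable_fun [set: T] g -> (forall i, measurable_fun [set: T] (F i)) ->
  measurable_fun [set: T] (fun x => \big[Num.max/g x]_(i <- r) F i x).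
Proof.
move=> mg mF; elim: r => [|i r IH].
  by under eq_fun do rewrite big_nil.
by under eq_fun do rewrite big_cons; exact: measurable_maxr.
Qed.

Lemma measurable_bigmin (disp : measure_display) (T : measurableType disp)
    (I : Type) (r : seq I) (g : T -> R) (F : I -> T -> R) :
  measurable_fun [set: T] g -> (forall i, measurable_fun [set: T] (F i)) ->
  measurable_fun [set: T] (fun x => \big[Num.min/g x]_(i <- r) F i x).
Proof.
move=> mg mF; elim: r => [|i r IH].
  by under eq_fun do rewrite big_nil.
by under eq_fun do rewrite big_cons; exact: measurable_minr.
Qed.

Lemma measurable_dot k (v : 'cV[R]_k) :
  measurable_fun [set: borel 'cV[R]_k] (dot v : borel 'cV[R]_k -> R).
Proof.
apply: measurable_sum => i; apply: measurable_funM => //.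
by apply: measurable_genR; apply/continuousP => x; exact: coord_continuous.
Qed.

(** The norm of one block is only a seminorm of [u]. Adding the max norm gives a norm, which is
    continuous, and subtracting the max norm preserves continuity. *)
Lemma continuous_norm_block (n : nat) (d : 'I_n -> nat) k (N : 'cV[R]_(d k) -> R) :
  is_norm N -> continuous (fun u : 'cV[R]_(\sum_k d k) => N (submxcol u k)).
Proof.
move=> hN.
have hN' : is_norm (fun u : 'cV[R]_(\sum_k d k) => N (submxcol u k) + `|u|).
  split=> [u v|x u|u /eqP].
  - by rewrite submxcolD addrACA lerD ?(norm_tri hN) ?ler_normD.
  - by rewrite submxcolZ (norm_scale hN) normrZ mulrDr.
  - rewrite paddr_eq0 ?(norm_nneg hN)// => /andP[_].
    by rewrite normr_eq0 => /eqP.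
rewrite (_ : (fun u => _) =
    (fun u : 'cV_(\sum_k d k) => (N (submxcol u k) + `|u|) - `|u|)).
  by move=> u; exact: (cvgB (is_norm_continuous hN' (x:=u)) (@norm_continuous _ _ u)).
by apply/funext => u; rewrite addrK.
Qed.

End MeasurableFunctions.

Section Transport.
Variables (R : realType) (n M : nat) (d : 'I_n -> nat).
Notation vec := 'cV[R]_(\sum_k d k).
Variables (Nk : forall k, 'cV[R]_(d k) -> R) (Xi : set vec) (p : R).
Variables (theta : 'I_M -> R) (atom : 'I_M -> vec).
Variables (Q : probability (borel vec) R) (eps : 'cV[R]_n).
Hypothesis hNk : forall k, is_norm (@Nk k).
Hypothesis hXi : compact Xi.
Hypothesis htheta : forall l, 0 <= theta l.
Hypothesis hQ : forall B : set (borel vec), measurable B ->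
  Q B = (\sum_l (theta l)%:E * \d_(atom l : borel vec) B)%E.
Hypothesis hatom : forall l, Xi (atom l).
Hypothesis heps : forall k, 0 <= eps k 0.
Hypothesis hp : 1 <= p.

Definition cost k (w : vec * vec) : R := Nk (submxcol w.1 k - submxcol w.2 k).

Lemma measurable_support : measurable (Xi : set (borel vec)).
Proof.
apply: measurable_genC; apply: closed_openC; apply: compact_closed hXi.
exact: norm_hausdorff.
Qed.

Lemma measurable_fst :
  measurable_fun [set: borel (vec * vec)%type]
    (fst : borel (vec * vec)%type -> borel vec).
Proof. by apply: measurable_gen; apply/continuousP => x; exact: cvg_fst. Qed.

Lemma measurable_snd :
  measurable_fun [set: borel (vec * vec)%type]
    (snd : borel (vec * vec)%type -> borel vec).
Proof. by apply: measurable_gen; apply/continuousP => x; exact: cvg_snd. Qed.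

Lemma measurable_cost k :
  measurable_fun [set: borel (vec * vec)%type] (cost k : borel (vec * vec)%type -> R).
Proof.
apply: measurable_genR; apply/continuousP => w.
rewrite (_ : cost k = (fun u : vec => Nk (submxcol u k)) \o
    (fun w : vec * vec => w.1 - w.2)); last first.
  by apply/funext => v; rewrite /cost /= submxcolB.
apply: continuous_comp; last exact: continuous_norm_block.
by apply: cvgB; [exact: cvg_fst|exact: cvg_snd].
Qed.

Lemma measurable_support2 : measurable (Xi `*` Xi : set (borel (vec * vec)%type)).
Proof.
rewrite (_ : _ `*` _ = fst @^-1` Xi `&` snd @^-1` Xi); last by apply/seteqP; split=> w.
apply: measurableI; rewrite -[X in measurable X]setTI.
  exact: measurable_fst measurable_support.
exact: measurable_snd measurable_support.
Qed.

Lemma transport_support P : transport_hyperrectangle Nk Xi p Q eps P ->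
  P (Xi : set (borel vec)) = 1%E.
Proof.
case=> pi [piXi _ piP _]; apply/eqP; rewrite eq_le probability_le1/=; last first.
  exact: measurable_support.
rewrite -piP; last exact: measurable_support.
rewrite -piXi; apply: le_measure; rewrite ?inE.
- exact: measurable_support2.
- by rewrite -[X in measurable X]setTI; exact: measurable_snd measurable_support.
- by move=> w [].
Qed.

Lemma theta_sum1 : \sum_l theta l = 1.
Proof.
apply: EFin_inj; rewrite -(@probability_setT _ _ _ Q) hQ// -sumEFin.
by apply: eq_bigr => l _; rewrite diracT mule1.
Qed.

(* [S] is the least [s l] over the atoms at a given point, since the atoms need
   not be distinct. *)
Lemma transport_bound P (G : vec -> R) (s : 'I_M -> R) (lambda : 'cV[R]_n) :
  transport_hyperrectangle Nk Xi p Q eps P ->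
  measurable_fun [set: borel vec] (G : borel vec -> R) ->
  (forall xi, 0 <= G xi) -> (forall l, 0 <= s l) -> (forall k, 0 <= lambda k 0) ->
  (forall l xi, Xi xi -> G xi <=
     s l + \sum_k lambda k 0 * Nk (submxcol (atom l - xi) k)) ->
  (\int[P]_(xi in Xi) (G xi)%:E <= (\sum_l theta l * s l + dot lambda eps)%:E)%E.
Proof.
move=> [pi [piXi piQ piP cost_le]] mG G0 s0 lam0 Gle.
have mXi := measurable_support; have mXi2 := measurable_support2.
(* [K] bounds every [s l]. It is the value of the [l]-th term of [S] away from [atom l], so that
   only the atoms located at [z] can lower the minimum. *)
pose K := \sum_l s l.
have sK l : s l <= K by rewrite /K (bigD1 l)//= lerDl sumr_ge0.
pose S (z : borel vec) : R :=
  \big[Num.min/K]_l (K + (s l - K) * \1_[set atom l] z).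
have mS : measurable_fun [set: borel vec] S.
  apply: measurable_bigmin => [|l]; first exact: measurable_cst.
  apply: measurable_funD; first exact: measurable_cst.
  apply: measurable_funM; first exact: measurable_cst.
  apply: measurable_indic; apply: measurable_genC; apply: closed_openC.
  by apply: accessible_closed_set1; apply: hausdorff_accessible; exact: norm_hausdorff.
have S_ge c z : c <= K -> (forall l, atom l = z -> c <= s l) -> c <= S z.
  move=> cK cs; apply: le_bigmin => // l _; rewrite indicE.
  have [zl|/eqP zl] := eqVneq z (atom l).
    by rewrite mem_set// mulr1 addrC subrK cs.
  by rewrite memNset// mulr0 addr0.
have S0 z : 0 <= S z by apply: S_ge => //; exact: sumr_ge0.
have S_atom l : S (atom l) <= s l.
  apply/bigmin_leP; right; exists l => //.
  by rewrite indicE mem_set// mulr1 addrC subrK.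
have intQ : (\int[Q]_z (S z)%:E <= (\sum_l theta l * s l)%:E)%E.
  rewrite (integral_discrete htheta hQ)//; last 2 first.
  - exact/measurable_EFinP.
  - by move=> z _; rewrite lee_fin.
  rewrite -sumEFin; apply: lee_sum => l _; rewrite -EFinM lee_fin.
  exact: ler_wpM2l.
have mSf : measurable_fun [set: borel (vec * vec)%type] (S \o fst).
  exact: measurableT_comp measurable_fst.
have mGs : measurable_fun [set: borel (vec * vec)%type] (G \o snd).
  exact: measurableT_comp measurable_snd.
have cost0 k w : 0 <= cost k w by exact: (norm_nneg (hNk k)).
have intS : (\int[pi]_(w in Xi `*` Xi) (S w.1)%:E <= (\sum_l theta l * s l)%:E)%E.
  rewrite (le_trans _ intQ)//.
  rewrite [leRHS](ge0_integral_marginal measurable_fst piQ)//; last 2 first.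
  - exact/measurable_EFinP.
  - by move=> z _; rewrite lee_fin.
  rewrite preimage_setT; apply: ge0_subset_integral => //.
  - exact/measurable_EFinP.
  - by move=> w _; rewrite lee_fin.
have mset1 l : measurable ([set atom l] : set (borel vec)).
  apply: measurable_genC; apply: closed_openC.
  by apply: accessible_closed_set1; apply: hausdorff_accessible; exact: norm_hausdorff.
have mC : measurable (~` (Xi `*` Xi) : set (borel (vec * vec)%type)).
  exact: measurableC.
have piC : pi (~` (Xi `*` Xi) : set (borel (vec * vec)%type)) = 0%E.
  by rewrite probability_setC// piXi subee.
(* The preimage of [Xi] under [snd] differs from the product only by a null set of the plan. *)
have intG : (\int[P]_(xi in Xi) (G xi)%:E =
    \int[pi]_(w in Xi `*` Xi) (G w.2)%:E)%E.
  rewrite (ge0_integral_marginal measurable_snd piP)//; last 2 first.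
  - by apply: measurable_funTS; exact/measurable_EFinP.
  - by move=> z _; rewrite lee_fin.
  rewrite (@ge0_negligible_integral _ _ _ pi _
    (~` (Xi `*` Xi) : set (borel (vec * vec)%type)))//; last 3 first.
  - by rewrite -[X in measurable X]setTI; exact: measurable_snd.
  - by apply: measurable_funTS; exact/measurable_EFinP.
  - by move=> z _; rewrite lee_fin.
  congr (integral _ _ _); apply/seteqP; split=> [w [_ /contrapT]//|w ww].
  by split; [case: ww|apply: contra_notP => /contrapT].
(* Almost surely the first coordinate is an atom, and only there is the pointwise bound
   available. *)
pose A0 : set (borel vec) := ~` (\bigcup_l [set atom l]).
have mA0 : measurable A0.
  by apply: measurableC; apply: fin_bigcup_measurable => //; exact: finite_finset.
have piA0 : pi (fst @^-1` A0) = 0%E.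
  rewrite piQ// hQ// big1// => l _; rewrite diracE memNset ?mule0//.
  by apply; exists l.
rewrite intG.
have mlc k : measurable_fun [set: borel (vec * vec)%type]
    (fun w => (lambda k 0)%:E * (cost k w)%:E)%E.
  by apply: measurable_funeM; apply/measurable_EFinP; exact: measurable_cost.
have lc0 k w : (0 <= (lambda k 0)%:E * (cost k w)%:E)%E.
  by rewrite -EFinM lee_fin mulr_ge0.
apply: (@le_trans _ _ (\int[pi]_(w in Xi `*` Xi)
    ((S w.1)%:E + \sum_k (lambda k 0)%:E * (cost k w)%:E))%E).
  apply: ae_ge0_le_integral => //.
  - by move=> w _; rewrite lee_fin.
  - by apply: measurable_funTS; exact/measurable_EFinP.
  - by move=> w _; rewrite adde_ge0 ?lee_fin// sume_ge0.
  - apply: measurable_funTS; apply: emeasurable_funD; first exact/measurable_EFinP.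
    exact: emeasurable_sum.
  exists (fst @^-1` A0); split; last first.
  - move=> w /= nle [l _ wl]; apply: nle => -[_ Xi2].
    rewrite (eq_bigr (fun k => (lambda k 0 * cost k w)%:E))//.
    rewrite sumEFin -EFinD lee_fin -lerBlDr; apply: S_ge => [|l' wl'].
      apply: le_trans (sK l); rewrite lerBlDr (le_trans (Gle l _ Xi2))// lerD2l.
      by apply: ler_sum => k _; rewrite /cost wl submxcolB.
    rewrite lerBlDr (le_trans (Gle l' _ Xi2))// lerD2l.
    by apply: ler_sum => k _; rewrite /cost -wl' submxcolB.
  - exact: piA0.
  - by rewrite -[X in measurable X]setTI; exact: measurable_fst.
rewrite ge0_integralD//; last 4 first.
- by move=> w _; rewrite lee_fin.
- by apply: measurable_funTS; exact/measurable_EFinP.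
- by move=> w _; rewrite sume_ge0.
- by apply: measurable_funTS; exact: emeasurable_sum.
rewrite EFinD leeD// ge0_integral_sum//; last first.
  by move=> k; apply: measurable_funTS.
rewrite /dot -sumEFin; apply: lee_sum => k _.
rewrite ge0_integralZl_EFin//; last 2 first.
- by move=> w _; rewrite lee_fin.
- by apply: measurable_funTS; apply/measurable_EFinP; exact: measurable_cost.
(* Jensen's inequality turns the bound on the [p]-th moment of the displacement into the bound
   [eps k 0] on its mean. *)
rewrite EFinM lee_wpmul2l ?lee_fin//; apply: (integral_le_powR hp) => //.
- by apply: measurable_funTS; exact: measurable_cost.
- exact: cost_le.
Qed.

End Transport.

(** * Transport plans built from dual multipliers, for exponent 1 *)

Section WorstCase.
Variables (R : realType) (n M m q : nat) (d : 'I_n -> nat).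
Notation vec := 'cV[R]_(\sum_k d k).
Variables (Nk : forall k, 'cV[R]_(d k) -> R).
Variables (C : 'M[R]_(q, \sum_k d k)) (h : 'cV[R]_q).
Variables (theta : 'I_M -> R) (atom : 'I_M -> vec).
Variables (Q : probability (borel vec) R) (eps : 'cV[R]_n) (alpha : R).
Variables (a : 'I_m -> vec) (beta : 'I_m -> R).
Hypothesis hNk : forall k, is_norm (@Nk k).
Hypothesis hXi : compact (polyhedron C h).
Hypothesis hQ : forall B : set (borel vec), measurable B ->
  Q B = (\sum_l (theta l)%:E * \d_(atom l : borel vec) B)%E.
Hypothesis hatom : forall l, polyhedron C h (atom l).

(** For positive [mu] the hypothesis is the membership of the target, scaled by [mu]. For [mu = 0]
    it makes [y] a recession direction of a compact polyhedron, hence zero. *)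
Lemma displaced_support (mu : R) l (y : vec) : 0 <= mu ->
  (forall e, (C *m y) e 0 <= mu * (h - C *m atom l) e 0) ->
  polyhedron C h (atom l + mu^-1 *: y) /\ y = mu *: (mu^-1 *: y).
Proof.
have addE (u v : 'cV[R]_q) e : (u + v) e 0 = u e 0 + v e 0 by rewrite mxE.
have scaleE c (u : 'cV[R]_q) e : (c *: u) e 0 = c * u e 0 by rewrite mxE.
have subE (u v : 'cV[R]_q) e : (u - v) e 0 = u e 0 - v e 0 by rewrite !mxE.
move=> mu0 hy; have [muE|muN] := eqVneq mu 0.
  suff -> : y = 0 by rewrite !scaler0 addr0.
  apply: (compact_ray (x := atom l) hXi) => t t0 e.
  have := hy e; rewrite muE mul0r => hye.
  rewrite mulmxDr -scalemxAr addE scaleE.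
  have h1 := hatom l e; have h2 := mulr_ge0_le0 t0 hye; lra.
split=> [e|]; last by rewrite scalerA divff// scale1r.
have mu_gt0 : 0 < mu by rewrite lt_def muN.
rewrite mulmxDr -scalemxAr addE scaleE mulrC -lerBrDl ler_pdivrMr// mulrC.
by rewrite -subE.
Qed.

(** The plan moves mass [mu l j] from [atom l] to [x_ l j] and leaves the rest of [theta l] in
    place. It does not depend on [tau]. *)
Lemma worst_case (mu : 'I_M -> 'I_m -> R) (y : 'I_M -> 'I_m -> vec)
    (phi : vec -> R) :
  dual_feasible Nk C h theta atom eps alpha 1 mu y ->
  measurable_fun [set: borel vec] (phi : borel vec -> R) ->
  (forall xi j, polyhedron C h xi -> beta j + dot (a j) xi <= phi xi) ->
  exists P, transport_hyperrectangle Nk (polyhedron C h) 1 Q eps P /\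
    forall tau, ((dual_value atom a beta mu y)%:E <= \int[P]_(xi in polyhedron C h)
      (Num.max (phi xi + tau) 0 - tau * alpha)%:E)%E.
Proof.
move=> [mu0 mu_alpha mu_theta supp cost_le] mphi phi_ge; set Xi := polyhedron C h.
pose x_ l j : vec := atom l + (mu l j)^-1 *: y l j.
have x_Xi l j : Xi (x_ l j) by case: (displaced_support (mu0 l j) (supp l j)).
have yE l j : y l j = mu l j *: (x_ l j - atom l).
  by rewrite /x_ addrAC subrr add0r; case: (displaced_support (mu0 l j) (supp l j)).
have mXi := measurable_support hXi; have mXi2 := measurable_support2 hXi.
pose I : finType := ('I_M + 'I_M * 'I_m)%type.
pose w (i : I) : R := match i with
  | inl l => theta l - \sum_j mu l j | inr (l, j) => mu l j end.
pose pt (i : I) : vec * vec := match i with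
  | inl l => (atom l, atom l) | inr (l, j) => (atom l, x_ l j) end.
have w0 i : 0 <= w i.
  case: i => [l|[l j]] /=; last exact: mu0.
  by rewrite subr_ge0 (le_trans (mu_theta l))// mul1r.
have sumI (F : I -> R) :
    \sum_i F i = \sum_l F (inl l) + \sum_l \sum_j F (inr (l, j)).
  rewrite big_sumType/=; congr (_ + _).
  by rewrite pair_bigA/=; apply: eq_bigr => -[].
(* The weights leaving [atom l] add up to [theta l]; hence the first marginal is [Q] and the total
   mass is 1. *)
have pt1 (F : vec -> R) : \sum_i w i * F (pt i).1 = \sum_l theta l * F (atom l).
  rewrite sumI -big_split; apply: eq_bigr => l _ /=.
  by rewrite -mulr_suml -mulrDl subrK.
have w1 : \sum_i w i = 1.
  rewrite -(theta_sum1 hQ); have := pt1 (fun=> 1).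
  by under eq_bigr do rewrite mulr1; under [RHS]eq_bigr do rewrite mulr1.
have ptXi i : (Xi `*` Xi) (pt i).
  by case: i => [l|[l j]]; split; by [exact: hatom|exact: x_Xi].
have [pi piE] := discrete_probability (pt : I -> borel (vec * vec)%type) w0 w1.
have [P PE] := discrete_probability ((snd \o pt) : I -> borel vec) w0 w1.
have sumE (F : I -> R) : (\sum_i (w i)%:E * (F i)%:E = (\sum_i w i * F i)%:E)%E.
  by rewrite -sumEFin; apply: eq_bigr => i _; rewrite EFinM.
exists P; split.
  exists pi; split.
  - rewrite piE -w1 -sumEFin; apply: eq_bigr => i _.
    by rewrite diracE mem_set ?mule1.
  - move=> B mB; rewrite piE hQ//.
    have := congr1 EFin (pt1 (fun z => \1_B z)).
    by rewrite -sumE -sumEFin; under [RHS]eq_bigr do rewrite EFinM.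
  - by move=> B mB; rewrite piE PE.
  - move=> k; rewrite (integral_discrete w0 (fun A _ => piE A))//; last 2 first.
    + apply: measurable_funTS; apply/measurable_EFinP.
      apply: (measurableT_comp (measurable_powR 1)).
      exact: (measurable_cost hNk k).
    + by move=> z _; rewrite lee_fin powR_ge0.
    rewrite sumE lee_fin sumI big1 ?add0r => [|l _]; last first.
      by rewrite /= subrr norm_zero// powRr1// mulr0.
    have eps0 : 0 <= eps k 0.
      have := cost_le k; rewrite mul1r; apply: le_trans.
      by apply: sumr_ge0 => l _; apply: sumr_ge0 => j _; exact: (norm_nneg (hNk k)).
    rewrite powRr1// -[leRHS]mul1r (le_trans _ (cost_le k))//.
    apply: ler_sum => l _; apply: ler_sum => j _ /=.
    rewrite powRr1 ?(norm_nneg (hNk k))// yE submxcolZ (norm_scale (hNk k)).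
    by rewrite ger0_norm// -submxcolB -opprB submxcolN (norm_opp (hNk k)).
move=> tau; pose G (xi : borel vec) : R := Num.max (phi xi + tau) 0.
have mG : measurable_fun [set: borel vec] G.
  apply: measurable_maxr => //; apply: measurable_funD => //.
have G0 xi : 0 <= G xi by rewrite /G le_max lexx orbT.
have PXi : P (Xi : set (borel vec)) = 1%E.
  rewrite PE -w1 -sumEFin; apply: eq_bigr => i _.
  by rewrite diracE mem_set ?mule1//; case: (ptXi i).
have intG : (\int[P]_(xi in Xi) (G xi)%:E = (\sum_i w i * G (pt i).2)%:E)%E.
  rewrite (integral_discrete w0 (fun A _ => PE A))//.
  - by apply: measurable_funTS; exact/measurable_EFinP.
  - by move=> z _; rewrite lee_fin.
  - by move=> i; case: (ptXi i).
rewrite (integral_subr (g := G) _ mXi PXi)//; last 2 first.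
- exact: measurable_funTS.
- by rewrite intG ltry.
(* The moved mass is exactly [alpha], so [tau * alpha] cancels against the shift by [tau] on the
   moved part. On the mass left in place the positive part is bounded below by 0. *)
rewrite intG -EFinB lee_fin lerBrDr sumI -[tau * alpha]mulr1.
rewrite -mulrA -mu_alpha mulr_sumr -big_split/= -[leLHS]add0r lerD//.
  by apply: sumr_ge0 => l _; rewrite mulr_ge0// (w0 (inl l)).
apply: ler_sum => l _; rewrite mulr_sumr -big_split/=; apply: ler_sum => j _.
rewrite yE dotZr (dotBr (a j)).
have G_ge : beta j + dot (a j) (x_ l j) + tau <= G (x_ l j).
  by rewrite /G le_max lerD2r phi_ge//; exact: x_Xi.
have := ler_wpM2l (mu0 l j) G_ge; rewrite /w /pt /=; lra.
Qed.

End WorstCase.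

(** * The reformulation *)

Section Reformulation.
Variables (R : realType) (ell NI n M m q : nat) (d : 'I_n -> nat).
Notation vec := 'cV[R]_(\sum_k d k).
Variables (Nk : forall k, 'cV[R]_(d k) -> R).
Variables (alpha : 'I_NI -> R) (g : 'cV[R]_ell) (X : set 'cV[R]_ell).
Variables (C : 'M[R]_(q, \sum_k d k)) (h : 'cV[R]_q).
Variables (theta : 'I_M -> R) (atom : 'I_M -> vec) (eps : 'cV[R]_n).
Variables (A : 'I_m -> 'I_NI -> 'M[R]_(ell, \sum_k d k)).
Variables (b : 'I_m -> 'I_NI -> 'cV[R]_ell -> R).

Lemma dual_norm_le k (N : 'cV[R]_k -> R) z lambda :
  (dual_norm N z <= lambda%:E)%E <-> (forall u, N u <= 1 -> dot z u <= lambda).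
Proof.
split=> [hz u Nu|hz]; last by apply: ge_ereal_sup => _ [u Nu <-]; rewrite lee_fin hz.
by rewrite -lee_fin (le_trans _ hz)//; apply: ereal_sup_ubound; exists u.
Qed.

(** All constraints are linear in the variables, apart from [b] and the dual norms, which are
    convex; the latter are handled through their defining linear inequalities. *)
Lemma reform_feasible_comb (c e : R) x1 x2 tau1 tau2 lam1 lam2 s1 s2
    (eta1 eta2 : 'I_M -> 'I_m -> 'I_NI -> 'cV[R]_q) : 0 <= c -> 0 <= e ->
  X (c *: x1 + e *: x2) ->
  (forall j i, b j i (c *: x1 + e *: x2) <= c * b j i x1 + e * b j i x2) ->
  reform_feasible Nk X C h theta atom eps alpha A b (x1, tau1, lam1, s1, eta1) ->
  reform_feasible Nk X C h theta atom eps alpha A b (x2, tau2, lam2, s2, eta2) ->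
  reform_feasible Nk X C h theta atom eps alpha A b
    (c *: x1 + e *: x2, fun i => c * tau1 i + e * tau2 i,
     fun i => c *: lam1 i + e *: lam2 i,
     fun l i => c * s1 l i + e * s2 l i,
     fun l j i => c *: eta1 l j i + e *: eta2 l j i).
Proof.
move=> c0 e0 Xx hb [X1 bud1 epi1 dual1 pos1] [X2 bud2 epi2 dual2 pos2].
have lin u1 u2 w1 w2 : u1 <= w1 -> u2 <= w2 -> c * u1 + e * u2 <= c * w1 + e * w2.
  by move=> ? ?; apply: lerD; apply: ler_wpM2l.
have zE i j l : (A j i)^T *m (c *: x1 + e *: x2)
    - C^T *m (c *: eta1 l j i + e *: eta2 l j i) =
    c *: ((A j i)^T *m x1 - C^T *m eta1 l j i)
    + e *: ((A j i)^T *m x2 - C^T *m eta2 l j i).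
  by rewrite !mulmxDr -!scalemxAr !scalerBr opprD addrACA.
split=> //.
- move=> i; rewrite dotDl !dotZl.
  rewrite (eq_bigr (fun l => c * (theta l * s1 l i) + e * (theta l * s2 l i))).
    by rewrite sum_lin; have := lin _ _ _ _ (bud1 i) (bud2 i); lra.
  by move=> l _; ring.
- move=> l j i; rewrite zE !dotDl !dotZl.
  by have := lin _ _ _ _ (epi1 l j i) (epi2 l j i); have := hb j i; lra.
- move=> l j i k; rewrite zE submxcolD !submxcolZ; apply/dual_norm_le => u Nu.
  rewrite dotDl !dotZl !mxE.
  by apply: lin; [move/dual_norm_le : (dual1 l j i k)|
                  move/dual_norm_le : (dual2 l j i k)]; apply.
- move=> l j i; have [s1p eta1p] := pos1 l j i; have [s2p eta2p] := pos2 l j i.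
  split; first by rewrite addr_ge0// mulr_ge0.
  by move=> k; rewrite !mxE addr_ge0// mulr_ge0.
Qed.

Lemma reform_vars_comb (c e : R) x1 x2 tau1 tau2 lam1 lam2 s1 s2 eta1 eta2 :
  c *: ((x1, tau1, lam1, s1, eta1) : reform_vars R ell NI n M m q)
    + e *: ((x2, tau2, lam2, s2, eta2) : reform_vars R ell NI n M m q) =
  (c *: x1 + e *: x2, fun i => c * tau1 i + e * tau2 i,
   fun i => c *: lam1 i + e *: lam2 i,
   fun l i => c * s1 l i + e * s2 l i,
   fun l j i => c *: eta1 l j i + e *: eta2 l j i).
Proof.
have pair_comb (U V : lmodType R) (u1 u2 : U) (v1 v2 : V) :
    c *: (u1, v1) + e *: (u2, v2) = (c *: u1 + e *: u2, c *: v1 + e *: v2) by [].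
by rewrite /reform_vars !pair_comb.
Qed.

Lemma reform_convex : convex_set X ->
  (forall j i, convex_function [set: 'cV[R]_ell] (b j i)) ->
  convex_problem (reform_problem Nk g X C h theta atom eps alpha A b).
Proof.
have convE (V : lmodType R) (t : {i01 R}) (v w : V) :
  conv t (v : convex_lmodType V) (w : convex_lmodType V) =
  t%:num *: v + (1 - t%:num) *: w by [].
move=> hX hb; split=> [v1 v2 t|t v1 v2 _ _].
  move=> /set_mem; case: v1 => [[[[x1 tau1] lam1] s1] eta1] feas1.
  move=> /set_mem; case: v2 => [[[[x2 tau2] lam2] s2] eta2] feas2.
  rewrite convE reform_vars_comb; apply/mem_set.
  have Xx1 : X x1 by case: feas1.
  have Xx2 : X x2 by case: feas2.
  apply: reform_feasible_comb feas1 feas2 => //.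
  - by apply/set_mem; rewrite -convE; apply: hX; rewrite inE.
  - by move=> j i; rewrite -convE; apply: hb; rewrite inE.
rewrite !convE; case: v1 => [[[[x1 tau1] lam1] s1] eta1].
case: v2 => [[[[x2 tau2] lam2] s2] eta2]; rewrite reform_vars_comb.
by rewrite /var_x [leLHS]dotDr !dotZr.
Qed.

End Reformulation.

(** Optimal values and minimizers depend only on the projected feasible set and the objective on
    it. *)
Lemma equivalent_via_feasible (R : realType) (U V : lmodType R) (pr : V -> U)
    (P1 : problem U) (P2 : problem V) :
  feasible P1 = [set pr v | v in feasible P2] ->
  (forall v, feasible P2 v -> objective P1 (pr v) = objective P2 v) ->
  equivalent_via pr P1 P2.
Proof.
move=> feasE objE; split=> //.
- congr ereal_inf; rewrite feasE; apply/seteqP; split.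
    by move=> _ [_ [v fv <-] <-]; exists v => //; rewrite objE.
  by move=> _ [v fv <-]; exists (pr v); [exists v|rewrite objE].
- apply/seteqP; split.
    move=> u [fu umin]; move: (fu); rewrite feasE => -[v fv vu].
    exists v => //; split=> // w fw; rewrite -!objE// vu; apply: umin.
    by rewrite feasE; exists w.
  move=> _ [v [fv vmin] <-]; split; first by rewrite feasE; exists v.
  by move=> u; rewrite feasE => -[w fw <-]; rewrite !objE//; exact: vmin.
Qed.

(** Weak duality at one fixed [tau], for every exponent [p >= 1]. The same [tau] serves all
    admissible [P]. *)
Lemma worst_case_cvar_le0 (R : realType) (n M m q : nat) (d : 'I_n -> nat)
    (Nk : forall k, 'cV[R]_(d k) -> R) (C : 'M[R]_(q, \sum_k d k)) (h : 'cV[R]_q)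
    (theta : 'I_M -> R) (atom : 'I_M -> 'cV[R]_(\sum_k d k))
    (Q : probability (borel 'cV[R]_(\sum_k d k)) R) (eps : 'cV[R]_n) (p alpha : R)
    (P : probability (borel 'cV[R]_(\sum_k d k)) R)
    (a : 'I_m -> 'cV[R]_(\sum_k d k)) (beta : 'I_m -> R)
    (phi : 'cV[R]_(\sum_k d k) -> R) (tau : R) (lambda : 'cV[R]_n) (s : 'I_M -> R)
    (eta : 'I_M -> 'I_m -> 'cV[R]_q) :
  (0 < m)%N -> 1 <= p -> (forall k, is_norm (Nk k)) -> compact (polyhedron C h) ->
  (forall l, 0 <= theta l) ->
  (forall B : set (borel 'cV[R]_(\sum_k d k)), measurable B ->
     Q B = (\sum_l (theta l)%:E * \d_(atom l : borel 'cV[R]_(\sum_k d k)) B)%E) ->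
  (forall k, 0 <= eps k 0) ->
  transport_hyperrectangle Nk (polyhedron C h) p Q eps P ->
  measurable_fun [set: borel 'cV[R]_(\sum_k d k)]
    (phi : borel 'cV[R]_(\sum_k d k) -> R) ->
  (forall xi c, (forall j, beta j + dot (a j) xi <= c) -> phi xi <= c) ->
  dot lambda eps + \sum_l theta l * s l <= tau * alpha ->
  (forall l j, beta j + tau + dot (a j - C^T *m eta l j) (atom l)
     + dot (eta l j) h <= s l) ->
  (forall l j k, (dual_norm (Nk k) (submxcol (a j - C^T *m eta l j) k)
     <= (lambda k 0)%:E)%E) ->
  (forall l j, 0 <= s l /\ forall e, 0 <= eta l j e 0) ->
  (\int[P]_(xi in polyhedron C h)
     (Num.max (phi xi + tau) 0 - tau * alpha)%:E <= 0)%E.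
Proof.
move=> hm hp hNk hXi htheta hQ heps PT mphi phi_le budget epi dual pos.
have mXi := measurable_support hXi.
pose G (xi : borel 'cV[R]_(\sum_k d k)) : R := Num.max (phi xi + tau) 0.
have mG : measurable_fun [set: borel 'cV[R]_(\sum_k d k)] G.
  by apply: measurable_maxr => //; apply: measurable_funD.
have G0 xi : 0 <= G xi by rewrite /G le_max lexx orbT.
(* Some atom exists because the masses add up to 1; a dual norm bound at that atom shows that
   [lambda] is nonnegative. *)
have [l0 _] : exists l : 'I_M, True.
  have [M0|M0] := posnP M; last by exists (Ordinal M0).
  have := theta_sum1 hQ; rewrite big1 => [/esym/eqP|]; first by rewrite oner_eq0.
  by case=> l lM; exfalso; move: lM; rewrite M0.
pose j0 := Ordinal hm.
have lam0 k : 0 <= lambda k 0 by case: (dual_norm_ge (hNk k) (dual l0 j0 k)).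
have intG : (\int[P]_(xi in polyhedron C h) (G xi)%:E <= (tau * alpha)%:E)%E.
  apply: (@le_trans _ _ (\sum_l theta l * s l + dot lambda eps)%:E%E); last first.
    by rewrite lee_fin addrC.
  apply: (transport_bound hNk hXi htheta hQ heps hp PT) => //.
    by move=> l; case: (pos l j0).
  move=> l xi xiXi; rewrite /G ge_max addr_ge0 ?andbT; last 2 first.
  - by case: (pos l j0).
  - by apply: sumr_ge0 => k _; rewrite mulr_ge0// (norm_nneg (hNk k)).
  rewrite -lerBrDr; apply: phi_le => j.
  (* The product [a . xi] splits into [z . xi] and [eta . (C xi)]. The latter is at most [eta . h]
     on the polyhedron, and [z . (xi - atom l)] is bounded block by block through the dual norms. *)
  set z := a j - C^T *m eta l j.
  have z_le : dot z (xi - atom l) <=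
      \sum_k lambda k 0 * Nk k (submxcol (atom l - xi) k).
    rewrite dot_blocks; apply: ler_sum => k _.
    have [_ /(_ (submxcol (xi - atom l) k)) zk] := dual_norm_ge (hNk k) (dual l j k).
    rewrite (le_trans zk)// -(norm_opp (hNk k)).
    by rewrite (_ : - submxcol _ _ = submxcol (atom l - xi) k) // -submxcolN opprB.
  have eta_le : dot (eta l j) (C *m xi) <= dot (eta l j) h.
    by apply: ler_dotr => // e; case: (pos l j).
  have aE : dot (a j) xi = dot z xi + dot (eta l j) (C *m xi).
    by rewrite /z dotBl dot_tr subrK.
  rewrite dotBr in z_le; have := epi l j; rewrite -/z aE; lra.
rewrite (integral_subr (g := G) _ mXi (transport_support hXi PT))//.
- by rewrite leeBlDr// add0e.
- exact: measurable_funTS.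
- exact: le_lt_trans intG (ltry _).
Qed.

Local Unset Implicit Arguments.

Theorem corollary7p5 (R : realType) (p r : R) (ell NI n M m q : nat)
    (d : 'I_n -> nat)
    (N : 'cV[R]_(\sum_k d k) -> R) (Nk : forall k, 'cV[R]_(d k) -> R)
    (alpha : 'I_NI -> R) (g : 'cV[R]_ell) (X : set 'cV[R]_ell)
    (C : 'M[R]_(q, \sum_k d k)) (h : 'cV[R]_q)
    (theta : 'I_M -> R) (atom : 'I_M -> 'cV[R]_(\sum_k d k))
    (Q : probability (borel 'cV[R]_(\sum_k d k)) R) (eps : 'cV[R]_n)
    (A : 'I_m -> 'I_NI -> 'M[R]_(ell, \sum_k d k))
    (b : 'I_m -> 'I_NI -> 'cV[R]_ell -> R)
    (f : 'I_NI -> 'cV[R]_ell -> 'cV[R]_(\sum_k d k) -> R)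
    (Xi := polyhedron C h)
    (hp : 1 <= p) (hNI : (0 < NI)%N) (hm : (0 < m)%N)
    (hN : is_norm N) (hNk : forall k, is_norm (Nk k))
    (halpha : forall i, 0 < alpha i < 1)
    (hXclosed : closed X) (hXconvex : convex_set X)
    (hXi : compact Xi)
    (hatom : forall l, Xi (atom l))
    (htheta : forall l, 0 <= theta l)
    (hQ : forall B : set (borel 'cV[R]_(\sum_k d k)), measurable B ->
       Q B = (\sum_l (theta l)%:E * \d_(atom l : borel 'cV[R]_(\sum_k d k)) B)%E)
    (heps : forall k, 0 <= eps k 0)
    (hfconvex : forall i xi, Xi xi -> convex_function X (fun x => f i x xi))
    (hr : 0 <= r < p)
    (hfcont : forall i x, X x -> {within Xi, continuous (f i x)})
    (hfgrowth : forall i x, X x -> growth_class N Xi r (f i x))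
    (hb : forall j i, convex_function [set: 'cV[R]_ell] (b j i))
    (hf : forall i x xi, X x -> Xi xi ->
       let piece j := dot x (A j i *m xi) + b j i x in
       f i x xi = \big[Num.max/piece (Ordinal hm)]_j piece j) :
  let dro := dro_problem g X Xi (transport_hyperrectangle Nk Xi p Q eps)
               alpha f in
  let reform := reform_problem Nk g X C h theta atom eps alpha A b in
  [/\ convex_problem reform,
      conservative_via (@var_x R ell NI n M m q) dro reform
    & p = 1 -> equivalent_via (@var_x R ell NI n M m q) dro reform].
Proof.
move=> dro reform.
pose piece i x j xi := dot x (A j i *m xi) + b j i x.
pose a (x : 'cV[R]_ell) i j := (A j i)^T *m x.
(* The formula for [f] is given on [Xi] only. Its extension [phi] to the whole space is Borel
   measurable and has the same integrals over [Xi]. *)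
pose phi i x xi : R := \big[Num.max/piece i x (Ordinal hm) xi]_j piece i x j xi.
have pieceE i x j xi : piece i x j xi = b j i x + dot (a x i j) xi.
  by rewrite /piece /a dot_tr addrC.
have mphi i x : measurable_fun [set: borel 'cV[R]_(\sum_k d k)]
    (phi i x : borel 'cV[R]_(\sum_k d k) -> R).
  have mpiece j : measurable_fun [set: borel 'cV[R]_(\sum_k d k)]
      (piece i x j : borel 'cV[R]_(\sum_k d k) -> R).
    rewrite (_ : piece i x j = (fun xi => b j i x + dot (a x i j) xi)).
      by apply: measurable_funD => //; exact: measurable_dot.
    by apply/funext => xi; exact: pieceE.
  exact: measurable_bigmax.
have phi_le i x xi c : (forall j, b j i x + dot (a x i j) xi <= c) -> phi i x xi <= c.
  by move=> hc; apply: bigmax_le => [|j _]; rewrite pieceE.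
have phi_ge i x xi j : b j i x + dot (a x i j) xi <= phi i x xi.
  by rewrite -pieceE; exact: le_bigmax.
have cvarE (P : probability (borel 'cV[R]_(\sum_k d k)) R) i x tau : X x ->
    (\int[P]_(xi in (Xi : set (borel 'cV[R]_(\sum_k d k))))
       (Num.max (f i x xi + tau) 0 - tau * alpha i)%:E =
     \int[P]_(xi in (Xi : set (borel 'cV[R]_(\sum_k d k))))
       (Num.max (phi i x xi + tau) 0 - tau * alpha i)%:E)%E.
  move=> Xx; apply: eq_integral => xi /set_mem Xixi.
  by rewrite (hf i x xi Xx Xixi).
have conservative : conservative_via (@var_x R ell NI n M m q) dro reform.
  have sub : [set var_x v | v in feasible reform] `<=` feasible dro.
    move=> _ [[[[[x tau] lambda] s] eta] [/= Xx budget epi dual pos] <-].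
    split=> // i; apply: ge_ereal_sup => _ [P PT <-].
    apply: (@le_trans _ _ (\int[P]_(xi in (Xi : set (borel 'cV[R]_(\sum_k d k))))
      (Num.max (f i x xi + tau i) 0 - tau i * alpha i)%:E)%E).
      by apply: ereal_inf_lbound; exists (tau i).
    rewrite cvarE//.
    exact: (worst_case_cvar_le0 hm hp hNk hXi htheta hQ heps PT (mphi i x)
      (phi_le i x) (budget i) (fun l j => epi l j i) (fun l j => dual l j i)
      (fun l j => pos l j i)).
  split=> //; apply: le_ereal_inf_tmp => _ [v fv <-]; apply: ereal_inf_lbound.
  by exists (var_x v) => //; apply: sub; exists v.
split=> //; first exact: reform_convex.
move=> p1; apply: equivalent_via_feasible => //.
apply/seteqP; split; last by case: conservative.
move=> x [/= Xx dro_x].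
have dual i : exists t : R * 'cV[R]_n * ('I_M -> R) * ('I_M -> 'I_m -> 'cV[R]_q),
  [/\ dot t.1.1.2 eps + \sum_l theta l * t.1.2 l <= t.1.1.1 * alpha i,
      forall l j, b j i x + t.1.1.1 + dot (a x i j - C^T *m t.2 l j) (atom l)
        + dot (t.2 l j) h <= t.1.2 l,
      forall l j k, (dual_norm (Nk k) (submxcol (a x i j - C^T *m t.2 l j) k)
        <= (t.1.1.2 k 0)%:E)%E
    & forall l j, 0 <= t.1.2 l /\ forall e, 0 <= t.2 l j e 0].
  have [||tau [lambda [s [eta [h1 h2 h3 h4]]]]] := @lagrange_duality R n M m q d Nk C h
    theta atom eps (alpha i) (a x i) (fun j => b j i x) hNk heps htheta
    (theta_sum1 hQ) (halpha i) hatom hm.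
  - by move=> k z; exact: dual_norm_fin.
  (* The bound holds for all [tau] under the same [P], so it passes to the infimum over [tau];
     robust feasibility then makes the dual value nonpositive. *)
  - move=> mu y feas; have [P [PT P_ge]] := worst_case hNk hXi hQ hatom feas
      (mphi i x) (fun xi j _ => phi_ge i x xi j).
    rewrite -lee_fin; apply: (le_trans _ (dro_x i)).
    apply: (@le_trans _ _ (cvar_integral Xi P (f i x) (alpha i))).
      by apply: le_ereal_inf_tmp => _ [tau _ <-]; rewrite cvarE.
    by apply: ereal_sup_ubound; exists P => //; rewrite p1.
  by exists (tau, lambda, s, eta); split.
(* The constraints for different [i] share only [x], so their certificates are chosen
   independently. *)
have [t ht] := choice dual.
exists (x, fun i => (t i).1.1.1, fun i => (t i).1.1.2, fun l i => (t i).1.2 l,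
  fun l j i => (t i).2 l j) => //.
split=> //=.
- by move=> i; have [budget _ _ _] := ht i.
- by move=> l j i; have [_ epi _ _] := ht i; exact: epi.
- by move=> l j i; have [_ _ dual_le _] := ht i; exact: dual_le.
- by move=> l j i; have [_ _ _ pos] := ht i; exact: pos.
Qed.
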